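(* Let $d>13$ and, for $u\ge 0$, let $\mathcal{V}_u=\mathbb{Z}^d\setminus\mathcal{I}^u$ be the vacant set of random interlacements at level $u$. If $u$ is small enough (depending on $d$), then $$\mathbb{P}\big[\text{there exists } f\in S \text{ with } f(n)\in\mathcal{V}_u\cap\mathbb{Z}^2 \text{ for all } n\in\mathbb{N}_0\big]>0,$$ where $\mathbb{Z}^2$ is identified with the plane $\mathbb{Z}^2\times\{0\}^{d-2}\subset\mathbb{Z}^d$.
   Context: $S$ is the set of oriented paths $f:\mathbb{N}_0\to\mathbb{Z}^2$ with $f(n+1)-f(n)\in\{(0,1),(1,0)\}$ for all $n\in\mathbb{N}_0=\{0,1,2,\dots\}$ (with arbitrary starting point $f(0)\in\mathbb{Z}^2$). For $d\ge3$ and $u\ge0$, the random interlacement set $\mathcal{I}^u$ at level $u$ (Sznitman) is the random subset of $\mathbb{Z}^d$ given by the trace of a Poissonian cloud of doubly-infinite simple random walk trajectories with intensity parameter $u$; its law is characterized by $\mathbb{P}[\mathcal{I}^u\cap K=\emptyset]=e^{-u\,\mathrm{cap}(K)}$ for all finite $K\subset\mathbb{Z}^d$, where $\mathrm{cap}(K)=\sum_{x\in K}P_x[\text{simple random walk does not return to }K\text{ at positive times}]$. *)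

(* Defs.v *)
From HB Require Import structures.
From mathcomp Require Import all_boot all_order all_algebra finmap.
From mathcomp Require Import all_classical all_reals all_analysis.
Set Implicit Arguments.
Unset Strict Implicit.
Unset Printing Implicit Defensive.
Import Order.TTheory GRing.Theory Num.Theory.
Import numFieldNormedType.Exports.
Local Open Scope classical_set_scope.
Local Open Scope ring_scope.

Notation Zd d := 'rV[int]_d.

(* One-step transition probabilities of simple random walk on Z^d: the
   neighbours of x are the points at l^1-distance 1 from x. *)
Definition srw_step (R : realType) (d : nat) (x y : Zd d) : R :=
  if \sum_(i < d) `|(y - x) ord0 i| == 1 then (2 * d%:R)^-1 else 0.

(* Under Px x, the process X is simple random walk on Z^d started at x. *)
Definition is_simple_random_walk (R : realType) (d : nat)
    (dW : measure_display) (W : measurableType dW)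
    (Px : Zd d -> probability W R) (X : nat -> W -> Zd d) : Prop :=
  (forall n y, measurable (X n @^-1` [set y])) /\
  (forall (x : Zd d) (n : nat) (y : nat -> Zd d),
     Px x [set w | forall k, (k <= n)%N -> X k w = y k] =
     (if y 0%N == x then \prod_(k < n) srw_step R (y k) (y k.+1) else 0)%:E).

Definition capacity (R : realType) (d : nat)
    (dW : measure_display) (W : measurableType dW)
    (Px : Zd d -> probability W R) (X : nat -> W -> Zd d)
    (K : {fset (Zd d)}) : \bar R :=
  (\sum_(x <- K) Px x [set w | forall n, (0 < n)%N -> X n w \notin K])%E.

(* Sznitman's characterization of the law of random interlacements at level u.
   The first clause says that I is a random variable with values in the subsets
   of Z^d, endowed with the product sigma-algebra of {0,1}^(Z^d). *)
Definition is_random_interlacement (R : realType) (d : nat)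
    (dW : measure_display) (W : measurableType dW)
    (Px : Zd d -> probability W R) (X : nat -> W -> Zd d)
    (u : R) (dO : measure_display) (Omega : measurableType dO)
    (P : probability Omega R) (I : Omega -> set (Zd d)) : Prop :=
  (forall x : Zd d, measurable [set o | I o x]) /\
  (forall K : {fset (Zd d)},
     P [set o | I o `&` [set` K] = set0] =
     expeR (- (u%:E * capacity Px X K))%E).

Definition vacant_set (d : nat) (Omega : Type) (I : Omega -> set (Zd d))
    (o : Omega) : set (Zd d) := ~` I o.

(* The identification of Z^2 with Z^2 x {0}^(d-2). *)
Definition plane (d : nat) (p : int * int) : Zd d :=
  \row_(i < d) (if i == 0%N :> nat then p.1 else if i == 1%N :> nat then p.2 else 0).

Definition oriented_paths : set (nat -> int * int) :=
  [set f | forall n, f n.+1 - f n = (0, 1) \/ f n.+1 - f n = (1, 0)].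

(* Main.v *)
(* Divide the plane into blocks of side l. If the block at p meets the interlacement for every
   p in a finite set K, then it does so for a subset of at least |K|/4 coarse points whose
   coordinates have constant parity, so that distinct blocks are at distance of order l. For
   such a family the key estimate is P(all blocks are occupied) <= (e^{Cu} / z)^m, with m the
   number of blocks, z as large as desired provided l is large, and C depending on l and z.

   To prove it, write the capacity of A as the limit of 1/(n+1) times the expected number of
   starting points in Z^d from which an n-step walk hits A. Inclusion-exclusion over the
   blocks then turns the probability into a limit of covering probabilities of finite
   Poissonian clouds of subsets T (the blocks visited by a walk), and these are at most
   z^{-m} exp(sum of nu(T) (z^{|T|} - 1)). The exponential moment of |T| is bounded by a
   supermartingale: sum over the blocks j other than the last one visited of the
   superharmonic function x -> sum over y in block j of (1 + |x - y|^2/32)^{-2}. On a block,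
   this sum over the other blocks is O(l^{-2}).

   Oriented paths of vacant blocks contain oriented paths of vacant points, and a Peierls
   argument applies to the blocks: if the set W of blocks reached from the origin is bounded,
   then the contour of W through the bottom side of the origin, of length n, has at least n/4
   distinct occupied blocks across its upward sides, or else across its leftward sides. There
   are at most 4^n such contours. *)

Require Import Defs.
From HB Require Import structures.
From mathcomp Require Import all_boot all_order all_algebra finmap.
From mathcomp Require Import all_classical all_reals all_analysis.
From mathcomp Require Import ring lra zify.
Set Implicit Arguments.
Unset Strict Implicit.
Unset Printing Implicit Defensive.
Import Order.TTheory GRing.Theory Num.Theory.
Import numFieldNormedType.Exports.
Local Open Scope classical_set_scope.
Local Open Scope ring_scope.

(** * Simple random walk and a superharmonic potential *)

Section Walk.
Context {R : realType} {d : nat}.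
Implicit Types (f g : Zd d -> R) (x y : Zd d).

Definition stp (s : 'I_d * bool) : Zd d :=
  (if s.2 then 1 else -1) *: delta_mx ord0 s.1.

Definition avg f x : R := (2 * d%:R)^-1 * \sum_s f (x + stp s).

Lemma avg_ext f g x : f =1 g -> avg f x = avg g x.
Proof. by move=> fg; congr (_ * _); apply: eq_bigr => s _. Qed.

Lemma avgD f g x : avg (fun y => f y + g y) x = avg f x + avg g x.
Proof. by rewrite /avg big_split mulrDr. Qed.

Lemma avgZ a f x : avg (fun y => a * f y) x = a * avg f x.
Proof. by rewrite /avg -mulr_sumr mulrCA. Qed.

Lemma avg_sum (J : Type) (r : seq J) (P : pred J) (F : J -> Zd d -> R) x :
  avg (fun y => \sum_(j <- r | P j) F j y) x = \sum_(j <- r | P j) avg (F j) x.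
Proof. by rewrite /avg exchange_big /= mulr_sumr. Qed.

Lemma ler_avg f g x : (forall y, f y <= g y) -> avg f x <= avg g x.
Proof. by move=> fg; rewrite ler_wpM2l ?invr_ge0 ?mulr_ge0//; apply: ler_sum. Qed.

Lemma avg_cst (c : R) x : (0 < d)%N -> avg (fun=> c) x = c.
Proof.
move=> d0; rewrite /avg sumr_const card_prod card_ord card_bool -[c *+ _]mulr_natr natrM.
have dn : d%:R != 0 :> R by rewrite pnatr_eq0 -lt0n.
by field.
Qed.

Lemma avgE f x :
  avg f x = (2 * d%:R)^-1 * \sum_i (f (x + delta_mx ord0 i) + f (x - delta_mx ord0 i)).
Proof.
rewrite /avg -(pair_bigA _ (fun i b => f (x + stp (i, b)))) /=; congr (_ * _).
by apply: eq_bigr => i _; rewrite big_bool /stp /= scale1r scaleN1r.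
Qed.

Definition sqnorm x : R := \sum_i (x ord0 i)%:~R ^+ 2.

Lemma sqnorm_ge0 x : 0 <= sqnorm x.
Proof. by apply: sumr_ge0 => i _; exact: sqr_ge0. Qed.

Lemma sqnorm_shift x i (b : int) :
  sqnorm (x + b *: delta_mx ord0 i) =
  sqnorm x + 2 * (x ord0 i)%:~R * b%:~R + b%:~R ^+ 2.
Proof.
rewrite /sqnorm (bigD1 i) //= [\sum_i _ in RHS](bigD1 i) //= !mxE !eqxx mulr1 rmorphD /=.
under eq_bigr => j ji.
  rewrite !mxE eqxx /= (negPf ji) mulr0n mulr0 addr0.
  over.
by rewrite sqrrD; ring.
Qed.

(* This is (1 + |x|^2/A)^-2, where [A = 32] is large enough for superharmonicity at every
   point, including those near the origin. *)
Definition potential x : R := (32 / (32 + sqnorm x)) ^+ 2.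

(** Here [r] is 32 plus the squared norm of a point and [a] one of its coordinates, so the left side
    comes from two opposite neighbours. With y = 4 a^2 / (r + 1)^2 the claim is (1 + y) / (1 - y)^2
    <= 1 + 4 y, which holds since the constant 32 forces y <= 1/8. *)
Lemma potential_two_sided (r a : R) : 32 <= r -> a ^+ 2 <= r - 32 ->
  (r + 1 + 2 * a)^-1 ^+ 2 + (r + 1 - 2 * a)^-1 ^+ 2 <=
  2 * (r + 1)^-1 ^+ 2 * (1 + 16 * a ^+ 2 / (r + 1) ^+ 2).
Proof.
move=> r32 ar.
have s0 : 0 < r + 1 by lra.
set s := r + 1 in s0 *.
set y := 4 * a ^+ 2 / s ^+ 2.
have y0 : 0 <= y.
  rewrite /y; apply: divr_ge0; [apply: mulr_ge0 => //; exact: sqr_ge0|exact: sqr_ge0].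
have y8 : y <= 8^-1.
  rewrite /y ler_pdivrMr ?exprn_gt0 //.
  by rewrite /s; nra.
have sa1 : 0 < s + 2 * a by rewrite /s; nra.
have sa2 : 0 < s - 2 * a by rewrite /s; nra.
have -> : (s + 2 * a)^-1 ^+ 2 + (s - 2 * a)^-1 ^+ 2 =
          2 * s^-1 ^+ 2 * ((1 + y) / (1 - y) ^+ 2).
  rewrite /y; field.
  have -> : s * s - 4 * (a * a) = (s + 2 * a) * (s - 2 * a) by ring.
  by rewrite !mulf_neq0 ?gt_eqF.
rewrite ler_pM2l ?mulr_gt0 ?exprn_gt0 ?invr_gt0 //.
have -> : 1 + 16 * a ^+ 2 / s ^+ 2 = 1 + 4 * y by rewrite /y; ring.
clearbody y s => {r32 ar sa1 sa2 s0}.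
have y1 : 0 < 1 - y by lra.
rewrite ler_pdivrMr ?exprn_gt0 //.
have H1 : 0 <= y * (1 - 7 * y).
  by apply: mulr_ge0 => //; lra.
have H2 : 0 <= y * y * y by rewrite !mulr_ge0.
nra.
Qed.

(** Summing the two-sided bound over the coordinates turns the squares a^2 into [r - 32]; the
    averaging factor 1/d then leaves a second-order gain that [8 <= d] makes small enough to be
    beaten by the shift from [r] to [r + 1]. *)
Lemma potential_superharmonic x : (8 <= d)%N -> avg potential x <= potential x.
Proof.
move=> d8.
have D8 : 8 <= d%:R :> R by rewrite ler_nat.
have d0 : 0 < d%:R :> R by lra.
set r := 32 + sqnorm x.
have r32 : 32 <= r by rewrite /r; have := sqnorm_ge0 x; lra.
have sq i : (x ord0 i)%:~R ^+ 2 <= r - 32 :> R.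
  rewrite /r addrC addKr /sqnorm (bigD1 i) //= lerDl.
  by apply: sumr_ge0 => *; exact: sqr_ge0.
rewrite avgE mulrC ler_pdivrMr ?mulr_gt0 //.
have -> : potential x = 32 ^+ 2 * r^-1 ^+ 2 by rewrite /potential exprMn.
apply: (@le_trans _ _ (\sum_i (32 ^+ 2 * (2 * (r + 1)^-1 ^+ 2 *
    (1 + 16 * (x ord0 i)%:~R ^+ 2 / (r + 1) ^+ 2))))).
  apply: ler_sum => i _.
  rewrite -[delta_mx _ _]scale1r -scaleNr /potential !sqnorm_shift !exprMn -mulrDr.
  rewrite ler_pM2l ?exprn_gt0 //.
  apply: le_trans (potential_two_sided r32 (sq i)).
  rewrite le_eqVlt; apply/orP; left; apply/eqP; congr (_^-1 ^+ 2 + _^-1 ^+ 2); rewrite /r;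
  rewrite ?rmorphN /=; ring.
rewrite -mulr_sumr -[leRHS]mulrA ler_pM2l ?exprn_gt0 // -mulr_sumr big_split /=.
rewrite sumr_const card_ord -mulr_suml -mulr_sumr -/(sqnorm x).
have -> : sqnorm x = r - 32 by rewrite /r; ring.
set D := d%:R in D8 d0 *.
have s0 : 0 < r + 1 by lra.
have r0 : 0 < r by lra.
suff : (1 + 16 * (r - 32) / (r + 1) ^+ 2 / D) <= (r + 1) ^+ 2 / r ^+ 2.
  move=> H.
  have -> : 2 * (r + 1)^-1 ^+ 2 * (D + 16 * (r - 32) / (r + 1) ^+ 2) =
     2 * D * ((r + 1)^-1 ^+ 2 * (1 + 16 * (r - 32) / (r + 1) ^+ 2 / D)).
    by field; rewrite !gt_eqF.
  rewrite [leRHS]mulrC ler_pM2l ?mulr_gt0 // exprVn ler_pdivrMl ?exprn_gt0 //.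
  by rewrite exprVn.
(* The left side is at most 1 + 2 / r because 16 / d <= 2, and the right side is (1 + 1 / r)^2. *)
apply: (@le_trans _ _ (1 + 2 / r)).
  rewrite lerD2l ler_pdivrMr // ler_pdivrMr ?exprn_gt0 //.
  have -> : 2 / r * D * (r + 1) ^+ 2 = 2 * D * (r + 1) ^+ 2 / r.
    by field; rewrite gt_eqF.
  rewrite ler_pdivlMr //.
  have : 16 * (r + 1) ^+ 2 <= 2 * D * (r + 1) ^+ 2.
    by rewrite ler_pM2r ?exprn_gt0 //; lra.
  nra.
rewrite ler_pdivlMr ?exprn_gt0 //.
have -> : (1 + 2 / r) * r ^+ 2 = r ^+ 2 + 2 * r by field; rewrite gt_eqF.
nra.
Qed.
End Walk.

(** * Poissonian covering by inclusion-exclusion *)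

Section InclusionExclusion.
Context {R : realType} {I : finType}.
Implicit Types (N : {set I} -> R) (s : seq I) (J T : {set I}).

(* [incl_excl N s J] is the sum of (-1)^|K| N (J :|: K) over the subsets K of [s]. *)
Fixpoint incl_excl N s J : R :=
  if s is j :: s' then incl_excl N s' J - incl_excl N s' (j |: J) else N J.

Lemma incl_excl_ext N N' s J : N =1 N' -> incl_excl N s J = incl_excl N' s J.
Proof. by move=> NN'; elim: s J => [|j s IH] J /=; rewrite ?NN' ?IH. Qed.

Lemma incl_exclD N N' s J :
  incl_excl (fun K => N K + N' K) s J = incl_excl N s J + incl_excl N' s J.
Proof. by elim: s J => [//|j s IH] J /=; rewrite !IH; ring. Qed.

Lemma incl_exclZ a N s J : incl_excl (fun K => a * N K) s J = a * incl_excl N s J.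
Proof. by elim: s J => [//|j s IH] J /=; rewrite !IH; ring. Qed.

(** Terms whose index set meets [T] vanish, so only the elements of [s] outside [T] still contribute
    to the alternating sum. *)
Lemma incl_excl_disjoint N T s J :
  incl_excl (fun K => (T :&: K == finset.set0)%:R * N K) s J =
  (T :&: J == finset.set0)%:R * incl_excl N [seq j <- s | j \notin T] J.
Proof.
elim: s J => [//|j s IH] J /=; rewrite !IH finset.setIUr finset.setU_eq0.
have [jT|jT] /= := boolP (j \in T).
  rewrite (_ : T :&: [set j]%SET == finset.set0 = false) ?mul0r ?subr0 //.
  by apply/negbTE/finset.set0Pn; exists j; rewrite !inE jT eqxx.
rewrite (_ : T :&: [set j]%SET == finset.set0) ?mulrBr //.
by rewrite setI_eq0 disjoint_sym disjoints1.
Qed.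

Lemma incl_excl_cvg (N : nat -> {set I} -> R) N' s J :
  (forall K, N n K @[n --> \oo] --> N' K) -> incl_excl (N n) s J @[n --> \oo] --> incl_excl N' s J.
Proof. by move=> NN'; elim: s J => [|j s IH] J /=; [exact: NN'|exact: cvgB]. Qed.

Lemma incl_excl1 s : incl_excl (fun=> 1) s finset.set0 = (s == [::])%:R.
Proof.
case: s => [//|j s] /=.
suff E J K : incl_excl (fun=> 1) s J = incl_excl (fun=> 1) s K.
  by rewrite (E _ finset.set0) subrr.
by elim: s J K => [//|k s IH] J K /=; rewrite (IH _ K) (IH (k |: J) (k |: K)).
Qed.

Lemma size_filter_notin s T : uniq s ->
  (size s <= size [seq j <- s | j \notin T] + #|T|)%N.
Proof.
move=> us; rewrite addnC !size_filter -(count_predC (mem T)) leq_add2r.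
rewrite -size_filter cardE; apply: uniq_leq_size; first exact: filter_uniq.
by move=> j; rewrite mem_filter mem_enum => /andP[].
Qed.

(** A subset of intensity [c] is present with probability 1 - exp (- c) <= c and is then charged a
    factor [y]; the bound follows from 1 + x <= exp x. *)
Lemma poisson_mgf (c y : R) : 0 <= c -> 1 <= y ->
  expR (- c) + (1 - expR (- c)) * y <= expR (c * (y - 1)).
Proof.
move=> c0 y1; have := expR_ge1Dx (- c) => e1.
have : (1 - expR (- c)) * (y - 1) <= c * (y - 1) by rewrite ler_wpM2r; lra.
have := expR_ge1Dx (c * (y - 1)); nra.
Qed.

(* The left-hand side is the probability that a Poissonian cloud of subsets of [I] with
   intensity [l] covers [s]; the proof resolves one term of [l] at a time, according to
   whether that subset is present. *)
Lemma incl_excl_poisson_cover (l : seq (R * {set I})) (z : R) s :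
  {in l, forall t, 0 <= t.1} -> 1 <= z -> uniq s ->
  incl_excl (fun J => expR (- \sum_(t <- l) t.1 * (t.2 :&: J != finset.set0)%:R)) s finset.set0 <=
  z ^- size s * expR (\sum_(t <- l) t.1 * (z ^+ #|t.2| - 1)).
Proof.
move=> l0 z1; have z0 : 0 < z by lra.
elim: l l0 s => [_|[c T] l IH l0] s us.
  rewrite big_nil expR0 mulr1.
  rewrite (@incl_excl_ext _ (fun=> 1)); last by move=> J; rewrite big_nil oppr0 expR0.
  rewrite incl_excl1; case: s us => [|j s] us /=; first by rewrite expr0 invr1.
  by rewrite invr_ge0 exprn_ge0 // ltW.
have c0 : 0 <= c by apply: (l0 (c, T)); rewrite mem_head.
have {}IH := IH (fun t tl => l0 t (@mem_behead _ ((c, T) :: l) t tl)).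
pose N (J : {set I}) := expR (- \sum_(t <- l) t.1 * (t.2 :&: J != finset.set0)%:R).
rewrite (@incl_excl_ext _ (fun J => expR (- c) * N J +
    (1 - expR (- c)) * ((T :&: J == finset.set0)%:R * N J))); last first.
  move=> J; rewrite big_cons /= opprD expRD -/(N J).
  by case: eqP => _ /=; rewrite ?mulr0 ?oppr0 ?expR0 ?mulr1; ring.
rewrite incl_exclD !incl_exclZ incl_excl_disjoint finset.setI0 eqxx mul1r big_cons expRD.
set E := expR (\sum_(t <- l) _).
set y := z ^+ #|T|.
have y1 : 1 <= y by rewrite exprn_ege1.
have p1 : 0 <= 1 - expR (- c) by rewrite subr_ge0 -expR0 ler_expR; lra.
have E0 : 0 < E by rewrite expR_gt0.
have H1 := IH s us.
have H2 := IH _ (filter_uniq (fun j => j \notin T) us).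
(* When [T] is present, at most #|T| elements of [s] are covered for free, which costs at most the
   factor [y]. *)
have H3 : z ^- size [seq j <- s | j \notin T] <= z ^- size s * y.
  rewrite -ler_pdivrMl ?invr_gt0 ?exprn_gt0 // invrK.
  rewrite ler_pdivrMr ?exprn_gt0 // /y -exprD addnC ler_weXn2l //.
  exact: size_filter_notin.
apply: (@le_trans _ _ (expR (- c) * (z ^- size s * E) +
    (1 - expR (- c)) * (z ^- size s * y * E))).
  rewrite lerD // ler_wpM2l ?expR_ge0 //.
  by apply: le_trans H2 _; rewrite ler_wpM2r // ltW.
rewrite (_ : _ + _ = z ^- size s * E * (expR (- c) + (1 - expR (- c)) * y)); last by ring.
rewrite [leRHS](_ : _ = z ^- size s * E * expR (c * (y - 1))); last by rewrite /y; ring.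
rewrite ler_wpM2l ?poisson_mgf //.
by rewrite mulr_ge0 ?invr_ge0 ?exprn_ge0 // ltW.
Qed.
End InclusionExclusion.

(** * The set of blocks visited by a walk *)

Section LatticeSum.
Context {R : realType} {d : nat}.
Implicit Types (f g : Zd d -> R) (r : seq (Zd d)).

Definition supported_in r f := forall y, y \notin r -> f y = 0.
Definition finsupp f := exists r, supported_in r f.
(** A function of infinite support gets the default value 0, hence the support hypotheses in what
    follows. *)
Definition sumZ f : R := \sum_(y \in [set: Zd d]) f y.

Lemma sumZE r f : uniq r -> supported_in r f -> sumZ f = \sum_(y <- r) f y.
Proof.
move=> ur fr; rewrite /sumZ (fsbigE r) //; last by move=> y _; exact: fr.
by apply: eq_bigl => y; rewrite classical_sets.in_setT.
Qed.

Lemma finsupp_uniq f : finsupp f -> exists2 r, uniq r & supported_in r f.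
Proof.
by case=> r fr; exists (undup r); rewrite ?undup_uniq // => y; rewrite mem_undup; exact: fr.
Qed.

Lemma finsupp_uniq2 f g : finsupp f -> finsupp g ->
  exists r, [/\ uniq r, supported_in r f & supported_in r g].
Proof.
move=> [r fr] [r' gr]; exists (undup (r ++ r')); split; first exact: undup_uniq.
  by move=> y; rewrite mem_undup mem_cat negb_or => /andP[/fr].
by move=> y; rewrite mem_undup mem_cat negb_or => /andP[_ /gr].
Qed.

Lemma finsuppD f g : finsupp f -> finsupp g -> finsupp (fun y => f y + g y).
Proof.
move=> F G; have [r [_ fr gr]] := finsupp_uniq2 F G.
by exists r => y yr; rewrite fr // gr // addr0.
Qed.

Lemma sumZ_ext f g : f =1 g -> sumZ f = sumZ g.
Proof. by move=> /funext ->. Qed.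

Lemma sumZD f g : finsupp f -> finsupp g ->
  sumZ (fun y => f y + g y) = sumZ f + sumZ g.
Proof.
move=> F G; have [r [ur fr gr]] := finsupp_uniq2 F G.
rewrite (sumZE ur fr) (sumZE ur gr) -big_split; apply: sumZE => // y yr.
by rewrite fr // gr // addr0.
Qed.

Lemma finsuppZ a f : finsupp f -> finsupp (fun y => a * f y).
Proof. by case=> r fr; exists r => y yr; rewrite fr // mulr0. Qed.

Lemma sumZZ a f : finsupp f -> sumZ (fun y => a * f y) = a * sumZ f.
Proof.
move=> /finsupp_uniq[r ur fr]; rewrite (sumZE ur fr) mulr_sumr.
by apply: sumZE => // y yr; rewrite fr // mulr0.
Qed.

Lemma finsupp_sum (J : Type) (l : seq J) (P : pred J) (F : J -> Zd d -> R) :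
  (forall j, P j -> finsupp (F j)) -> finsupp (fun y => \sum_(j <- l | P j) F j y).
Proof.
move=> FF; elim: l => [|j l IH].
  by exists [::] => y _; rewrite big_nil.
rewrite (_ : (fun y => _) = fun y => (if P j then F j y else 0) + \sum_(j <- l | P j) F j y).
  apply: finsuppD => //; case Pj : (P j); first exact: FF.
  by exists [::].
by apply/funext => y; rewrite big_cons; case: ifP => //; rewrite add0r.
Qed.

Lemma sumZ_sum (J : Type) (l : seq J) (P : pred J) (F : J -> Zd d -> R) :
  (forall j, P j -> finsupp (F j)) ->
  sumZ (fun y => \sum_(j <- l | P j) F j y) = \sum_(j <- l | P j) sumZ (F j).
Proof.
move=> FF; elim: l => [|j l IH].
  rewrite big_nil (@sumZE [::]) ?big_nil // => y _; by rewrite big_nil.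
rewrite big_cons (sumZ_ext (g := fun y =>
  (if P j then F j y else 0) + \sum_(j <- l | P j) F j y)); last first.
  by move=> y; rewrite big_cons; case: ifP => //; rewrite add0r.
case Pj : (P j); first by rewrite sumZD ?IH //; [exact: FF|exact: finsupp_sum].
by rewrite -IH; apply: sumZ_ext => y; rewrite add0r.
Qed.

Lemma ler_sumZ f g : finsupp f -> finsupp g -> (forall y, f y <= g y) ->
  sumZ f <= sumZ g.
Proof.
move=> F G fg; have [r [ur fr gr]] := finsupp_uniq2 F G.
by rewrite (sumZE ur fr) (sumZE ur gr); apply: ler_sum.
Qed.

Lemma sumZ_ge0 f : (forall y, 0 <= f y) -> 0 <= sumZ f.
Proof. by move=> f0; apply: sumr_ge0. Qed.

Lemma finsupp_shift v f : finsupp f -> finsupp (fun y => f (y + v)).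
Proof.
case=> r fr; exists [seq x - v | x <- r] => y yr; apply: fr.
by apply: contra yr => yr; apply/mapP; exists (y + v); rewrite ?addrK.
Qed.

Lemma sumZ_shift v f : sumZ (fun y => f (y + v)) = sumZ f.
Proof.
rewrite /sumZ [RHS](reindex_fsbigT (fun y : Zd d => y + v)) //.
by exists (fun y => y - v) => y; rewrite ?addrK ?subrK.
Qed.

Lemma finsupp_avg f : finsupp f -> finsupp (avg f).
Proof.
by move=> F; apply: finsuppZ; apply: finsupp_sum => s _; exact: finsupp_shift.
Qed.

(** The counting measure is invariant for the walk, since every step is a translation. *)
Lemma sumZ_avg f : (0 < d)%N -> finsupp f -> sumZ (avg f) = sumZ f.
Proof.
move=> d0 F; rewrite -[RHS](avg_cst (sumZ f) 0 d0).
rewrite sumZZ; last by apply: finsupp_sum => s _; exact: finsupp_shift.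
rewrite sumZ_sum; last by move=> s _; exact: finsupp_shift.
by congr (_ * _); apply: eq_bigr => s _; rewrite sumZ_shift.
Qed.

Lemma sumZ_mem (K : {fset Zd d}) f :
  sumZ (fun y => (y \in K)%:R * f y) = \sum_(y <- K) f y.
Proof.
rewrite (@sumZE (enum_fset K)) ?fset_uniq //; last first.
  by move=> y yK; rewrite [y \in K](negPf yK) mul0r.
by rewrite big_seq [RHS]big_seq; apply: eq_bigr => y yK; rewrite [y \in K]yK mul1r.
Qed.

Lemma finsupp_mem (K : {fset Zd d}) f : finsupp (fun y => (y \in K)%:R * f y).
Proof. by exists (enum_fset K) => y yK; rewrite [y \in K](negPf yK) mul0r. Qed.

End LatticeSum.

(* The probability that simple random walk from [x] avoids [A] at the times 1, ..., k. *)
Fixpoint escape {R : realType} {d : nat} (A : {fset Zd d}) (k : nat) (x : Zd d) : R :=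
  if k is k'.+1 then avg (fun y => if y \in A then 0 else escape A k' y) x else 1.

Section VisitedSet.
Context {R : realType} {d : nat} {I : finType} (B : I -> {fset Zd d}).
Hypothesis d0 : (0 < d)%N.
Implicit Types (phi : {set I} -> R) (x y : Zd d) (T J : {set I}).

Definition at_blocks y : {set I} := [set j | y \in B j]%SET.

(* [visit_mean M phi y] is the mean of [phi T], for [T] the set of indices of the blocks visited
   in [M] steps by simple random walk started at [y]. *)
Fixpoint visit_mean M phi y : R :=
  if M is M'.+1 then avg (visit_mean M' (fun T => phi (at_blocks y :|: T))) y
  else phi (at_blocks y).

Lemma visit_mean_ext M phi psi y : phi =1 psi -> visit_mean M phi y = visit_mean M psi y.
Proof. by move=> /funext ->. Qed.

Lemma visit_mean_sum (K : Type) (l : seq K) (P : pred K) (F : K -> {set I} -> R) M y :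
  visit_mean M (fun T => \sum_(k <- l | P k) F k T) y = \sum_(k <- l | P k) visit_mean M (F k) y.
Proof.
elim: M F y => [//|M IH] F y /=; rewrite -avg_sum; apply: avg_ext => x.
by rewrite IH.
Qed.

Lemma visit_meanZ a M phi y : visit_mean M (fun T => a * phi T) y = a * visit_mean M phi y.
Proof.
by elim: M phi y => [//|M IH] phi y /=; rewrite -avgZ; apply: avg_ext => x; rewrite IH.
Qed.

Lemma ler_visit_mean M phi psi y : (forall T, phi T <= psi T) ->
  visit_mean M phi y <= visit_mean M psi y.
Proof.
elim: M phi psi y => [//|M IH] phi psi y le /=; first exact: le.
by apply: ler_avg => x; apply: IH.
Qed.

Lemma visit_mean_cst a M y : visit_mean M (fun=> a) y = a.
Proof.
elim: M y => [//|M IH] y /=; rewrite -[RHS](avg_cst a y d0).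
by apply: avg_ext => x; rewrite IH.
Qed.

Lemma visit_mean_ge0 M phi y : (forall T, 0 <= phi T) -> 0 <= visit_mean M phi y.
Proof. by move=> p0; rewrite -(visit_mean_cst 0 M y); exact: ler_visit_mean. Qed.

Lemma visit_mean_off M phi y : at_blocks y = finset.set0 ->
  visit_mean M.+1 phi y = avg (visit_mean M phi) y.
Proof.
move=> y0 /=; apply: avg_ext => x; apply: visit_mean_ext => T.
by rewrite y0 finset.set0U.
Qed.

Definition all_blocks : seq (Zd d) := flatten [seq enum_fset (B j) | j <- enum I].

Lemma at_blocks_eq0 y : y \notin all_blocks -> at_blocks y = finset.set0.
Proof.
move=> yB; apply/setP => j; rewrite !inE; apply: contraNF yB => yj.
by apply/flatten_mapP; exists j => //; rewrite mem_enum.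
Qed.

Lemma finsupp_visit_mean M phi : phi finset.set0 = 0 -> finsupp (visit_mean M phi).
Proof.
move=> p0; elim: M => [|M [r fr]].
  by exists all_blocks => y /at_blocks_eq0 /= ->.
have [r' fr'] := finsupp_avg (ex_intro _ r fr).
exists (all_blocks ++ r') => y; rewrite mem_cat negb_or => /andP[/at_blocks_eq0 y0 yr].
by rewrite visit_mean_off // fr'.
Qed.

Definition hits J T : R := (T :&: J != finset.set0)%:R.

Lemma hits0 J : hits J finset.set0 = 0.
Proof. by rewrite /hits finset.set0I eqxx. Qed.

Lemma visit_mean_on M J y : at_blocks y :&: J != finset.set0 -> visit_mean M (hits J) y = 1.
Proof.
move=> yJ; case: M => [|M] /=; first by rewrite /hits yJ.
rewrite -(avg_cst 1 y d0); apply: avg_ext => x.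
rewrite -[RHS](visit_mean_cst 1 M x); apply: visit_mean_ext => T; rewrite /hits finset.setIUl.
case/finset.set0Pn: yJ => j yj; rewrite (_ : _ != _) //.
by apply/finset.set0Pn; exists j; rewrite finset.inE yj.
Qed.

Section Union.
Variables (J : {set I}) (A : {fset Zd d}).
Hypothesis AJ : forall y, (y \in A) = (at_blocks y :&: J != finset.set0).

Lemma escape_visit_mean k y : (if y \in A then 0 else escape A k y) = 1 - visit_mean k (hits J) y.
Proof.
elim: k y => [|k IH] y; (case: ifPn => yA; first by rewrite visit_mean_on -?AJ ?subrr).
  by rewrite /= /hits -AJ (negPf yA) subr0.
rewrite /= (avg_ext y IH).
have -> : avg (fun x => 1 - visit_mean k (hits J) x) y = 1 - avg (visit_mean k (hits J)) y.
  rewrite -[X in _ = X - _](avg_cst 1 y d0) -mulN1r -avgZ -avgD.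
  by apply: avg_ext => x; rewrite mulN1r.
congr (1 - _); apply: avg_ext => x.
apply: visit_mean_ext => T; rewrite /hits finset.setIUl.
by move: yA; rewrite AJ negbK => /eqP ->; rewrite finset.set0U.
Qed.

(* First-step analysis: a walk from [y] that hits [A] does so after time 0 unless it
   starts from [A] and never comes back. *)
Lemma sumZ_hits M :
  sumZ (visit_mean M (hits J)) = \sum_(k < M.+1) \sum_(x <- A) escape A k x.
Proof.
elim: M => [|M IH].
  rewrite big_ord1 -sumZ_mem; apply: sumZ_ext => y.
  by rewrite /= /hits -AJ mulr1.
rewrite big_ord_recr [RHS]/= -IH -(sumZ_avg d0 (finsupp_visit_mean M (hits0 J))) -sumZ_mem.
rewrite -sumZD; [|exact/finsupp_avg/finsupp_visit_mean/hits0|exact: finsupp_mem].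
apply: sumZ_ext => y; have [yA|yA] := boolP (y \in A).
  rewrite visit_mean_on -?AJ // mul1r /= (avg_ext y (escape_visit_mean M)).
  by rewrite -avgD -[LHS](avg_cst 1 y d0); apply: avg_ext => x; ring.
rewrite mul0r addr0 /=; apply: avg_ext => x; apply: visit_mean_ext => T.
by rewrite /hits finset.setIUl; move: yA; rewrite AJ negbK => /eqP ->; rewrite finset.set0U.
Qed.
End Union.

(** By invariance of the counting measure, one more step can increase the sum only through starting
    points in [K], each by at most [C]. The growth in [M] is therefore linear, which the
    normalisation 1/(n+1) of the clouds will compensate. *)
Lemma sumZ_visit_mean_le (K : {fset Zd d}) (C : R) phi M : 0 <= C -> phi finset.set0 = 0 ->
  (forall y, y \notin K -> at_blocks y = finset.set0) ->
  (forall n y, y \in K -> visit_mean n phi y <= C) ->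
  (forall n y, 0 <= visit_mean n phi y) ->
  sumZ (visit_mean M phi) <= M.+1%:R * (C * #|` K|%:R).
Proof.
move=> C0 p0 KB EC E0.
have CK : C * #|` K|%:R = sumZ (fun y : Zd d => (y \in K)%:R * C).
  by rewrite sumZ_mem big_const_seq count_predT iter_addr_0 mulr_natr.
elim: M => [|M IH].
  rewrite mul1r CK; apply: ler_sumZ; [exact: finsupp_visit_mean|exact: finsupp_mem|].
  move=> y; have [yK|yK] := boolP (y \in K); first by rewrite mul1r; exact: EC.
  by rewrite /= KB // p0 mul0r.
rewrite -natr1 mulrDl mul1r; apply: le_trans (lerD IH (lexx _)).
rewrite -(sumZ_avg d0 (finsupp_visit_mean M p0)) CK -sumZD; first last.
- exact: finsupp_mem.
- exact/finsupp_avg/finsupp_visit_mean.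
apply: ler_sumZ; first exact: finsupp_visit_mean.
  by apply: finsuppD; [exact/finsupp_avg/finsupp_visit_mean|exact: finsupp_mem].
move=> y; have [yK|yK] := boolP (y \in K).
  rewrite mul1r (le_trans (EC _ _ yK)) // lerDr -(avg_cst 0 y d0).
  by apply: ler_avg => x; exact: E0.
by rewrite mul0r addr0 visit_mean_off // KB.
Qed.

(** The walks that miss every block have infinite total mass; the empty set, which covers nothing,
    is given mass 0 instead. *)
Definition visit_mass M T : R :=
  if T == finset.set0 then 0 else sumZ (visit_mean M (fun T' => (T' == T)%:R)).

Lemma visit_mass_ge0 M T : 0 <= visit_mass M T.
Proof. by rewrite /visit_mass; case: ifP => // _; apply: sumZ_ge0 => y; exact: visit_mean_ge0. Qed.

Lemma sum_visit_mass M phi : phi finset.set0 = 0 ->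
  \sum_T visit_mass M T * phi T = sumZ (visit_mean M phi).
Proof.
move=> p0; rewrite (sumZ_ext (g := fun y =>
    \sum_(T | T != finset.set0) phi T * visit_mean M (fun T' => (T' == T)%:R) y)); last first.
  move=> y; under eq_bigr do rewrite -visit_meanZ.
  rewrite -visit_mean_sum; apply: visit_mean_ext => T.
  have [->|T0] := eqVneq T finset.set0.
    rewrite p0 big1 // => S S0; by rewrite eq_sym (negPf S0) mulr0.
  rewrite (bigD1 T) //= eqxx mulr1 big1 ?addr0 // => S /andP[_ ST].
  by rewrite eq_sym (negPf ST) mulr0.
rewrite sumZ_sum; last first.
  by move=> T T0; apply: finsuppZ; apply: finsupp_visit_mean; rewrite eq_sym (negPf T0).
rewrite (bigD1 finset.set0) //= /visit_mass eqxx mul0r add0r; apply: eq_bigr => T T0.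
by rewrite (negPf T0) sumZZ 1?mulrC //; apply: finsupp_visit_mean; rewrite eq_sym (negPf T0).
Qed.

End VisitedSet.

(** * Exponential moment of the number of visited blocks *)

Section VisitCount.
Context {R : realType} {d : nat} {I : finType} (B : I -> {fset Zd d}).
Hypothesis d8 : (8 <= d)%N.
Variable z : R.
Hypothesis z1 : 1 <= z.
Implicit Types (x y : Zd d) (T J : {set I}).

Definition block_potential j y : R := \sum_(x <- B j) potential (y - x).

Hypothesis sep : forall i x, x \in B i -> \sum_(j | j != i) block_potential j x <= (2 * z)^-1.

Lemma potential_ge0 x : 0 <= potential x :> R.
Proof. exact: sqr_ge0. Qed.

Lemma block_potential_ge0 j y : 0 <= block_potential j y.
Proof. by apply: sumr_ge0 => x _; exact: potential_ge0. Qed.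

Lemma block_potential_ge1 j y : y \in B j -> 1 <= block_potential j y.
Proof.
move=> yj; rewrite /block_potential (big_fsetD1 y) //= subrr.
have -> : potential (0 : Zd d) = 1 :> R.
  rewrite /potential (_ : sqnorm _ = 0) ?addr0 ?divff ?expr1n //.
  by rewrite /sqnorm big1 // => i _; rewrite mxE mulr0z expr0n.
by rewrite lerDl; apply: sumr_ge0 => x _; exact: potential_ge0.
Qed.

Lemma block_potential_superharmonic j y : avg (block_potential j) y <= block_potential j y.
Proof.
rewrite /block_potential avg_sum; apply: ler_sum => x _.
rewrite (_ : avg _ y = avg potential (y - x)); first exact: potential_superharmonic.
by congr (_ * _); apply: eq_bigr => s _; rewrite addrAC.
Qed.

Definition other_potential i y : R := \sum_(j | j != i) block_potential j y.

Lemma other_potential_ge0 i y : 0 <= other_potential i y.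
Proof. by apply: sumr_ge0 => j _; exact: block_potential_ge0. Qed.

Lemma other_potential_ge1 i j y : y \in B j -> j != i -> 1 <= other_potential i y.
Proof.
move=> yj ji; rewrite /other_potential (bigD1 j) //= (le_trans (block_potential_ge1 yj)) // lerDl.
by apply: sumr_ge0 => k _; exact: block_potential_ge0.
Qed.

Lemma inv2z_lt1 : (2 * z)^-1 < 1.
Proof. by have h := z1; rewrite invf_lt1; lra. Qed.

(** At a common point the potential of the other blocks would be at least 1, against the bound
    1/(2z) < 1. *)
Lemma blocks_disjoint x i j : x \in B i -> x \in B j -> i = j.
Proof.
move=> xi xj; apply/eqP; apply/negPn/negP => ij.
have := sep xj; have := other_potential_ge1 xi ij; rewrite /other_potential.
have := inv2z_lt1; lra.
Qed.

Lemma at_blocks1 y j : y \in B j -> at_blocks B y = [set j]%SET.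
Proof.
move=> yj; apply/setP => k; rewrite !inE; apply/idP/eqP => [yk|->//].
exact: blocks_disjoint yk yj.
Qed.

(** The factor 2z makes this at most 2 on block [i], by [sep], and at least 2z on every other block;
    the ratio is the factor [z] paid for a new block. *)
Definition visit_bound i y : R := 1 + 2 * z * other_potential i y.

Lemma visit_bound_superharmonic i y : avg (visit_bound i) y <= visit_bound i y.
Proof.
rewrite /visit_bound avgD avg_cst ?(leq_trans _ d8) // avgZ lerD2l.
apply: ler_wpM2l; first by have := z1; lra.
rewrite /other_potential avg_sum; apply: ler_sum => j _; exact: block_potential_superharmonic.
Qed.

Lemma visit_bound_ge1 i y : 1 <= visit_bound i y.
Proof.
rewrite /visit_bound lerDl mulr_ge0 ?other_potential_ge0 //; have := z1; lra.
Qed.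

Lemma visit_bound_on i y : y \in B i -> visit_bound i y <= 2.
Proof.
move=> /sep; rewrite -/(other_potential i y) => H.
have z20 : 0 < 2 * z by have := z1; lra.
by rewrite /visit_bound -lerBrDl mulrC -ler_pdivlMr // (le_trans H) // -addrA subrr addr0 mul1r.
Qed.

(* A walk that last met block [i] sees [visit_bound i] decrease on average, and it drops by
   a factor [z] whenever a further block is entered. *)
Lemma visit_mean_bound M i y :
  visit_mean B M (fun T => z ^+ #|T :\ i|) y <= visit_bound i y.
Proof.
have z0 : 0 < z by have := z1; lra.
(* On entering block [j], the reference block changes from [i'] to [j], and the count rises by at
   most one, namely by [j] itself. *)
have grow i' (S T : {set I}) j : S \subset [set j]%SET ->
    z ^+ #|(S :|: T) :\ i'| <= z * z ^+ #|T :\ j|.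
  move=> Sj; rewrite -exprS ler_weXn2l //.
  apply: (@leq_trans #|j |: T|).
    by apply/subset_leq_card/(fintype.subset_trans (finset.subsetDl _ _))/finset.setSU.
  rewrite (cardsD1 j) finset.setU11 add1n ltnS.
  by apply/subset_leq_card/fintype.subsetP => k; rewrite !inE; case: eqP.
have switch i' j x : j != i' -> x \in B j -> z * visit_bound j x <= visit_bound i' x.
  move=> ji yj; apply: (@le_trans _ _ (z * 2)).
    by rewrite ler_wpM2l ?visit_bound_on // ltW.
  have := other_potential_ge1 yj ji; rewrite /visit_bound => H.
  have : 2 * z * 1 <= 2 * z * other_potential i' x by rewrite ler_wpM2l //; lra.
  lra.
elim: M i y => [|M IH] i y.
  have [[j ji yj]|yi] := pselect (exists2 j, j != i & y \in B j).
    apply: le_trans (switch _ _ _ ji yj).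
    rewrite /= (at_blocks1 yj) -[[set j]%SET]finset.setU0.
    apply: le_trans (grow i _ finset.set0 j (fintype.subxx _)) _.
    by rewrite ler_pM2l // finset.set0D cards0 expr0 visit_bound_ge1.
  rewrite /= (_ : _ :\ i = finset.set0) ?cards0 ?expr0 ?visit_bound_ge1 //.
  apply/setP => j; rewrite !inE; apply/negP => /andP[ji yj]; apply: yi; by exists j.
have [[j ji yj]|yi] := pselect (exists2 j, j != i & y \in B j).
  apply: le_trans (switch _ _ _ ji yj).
  apply: (@le_trans _ _ (z * avg (visit_bound j) y)).
    rewrite -avgZ /=; apply: ler_avg => x.
    apply: (@le_trans _ _ (visit_mean B M (fun T => z * z ^+ #|T :\ j|) x)).
      by apply: ler_visit_mean => T; apply: grow; rewrite (at_blocks1 yj).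
    by rewrite visit_meanZ ler_wpM2l // ltW.
  by rewrite ler_pM2l //; exact: visit_bound_superharmonic.
apply: le_trans (visit_bound_superharmonic i y) => /=; apply: ler_avg => x.
apply: le_trans (IH i x); rewrite le_eqVlt; apply/orP; left; apply/eqP.
apply: visit_mean_ext => T; congr (z ^+ #|pred_of_set _|).
apply/setP => j; rewrite !inE; case: eqVneq => //= ji.
by case: (boolP (y \in B j)) => // yj; case: yi; exists j.
Qed.

Lemma visit_mean_count M i y : y \in B i -> visit_mean B M (fun T => z ^+ #|T| - 1) y <= 2 * z.
Proof.
move=> yi; apply: (@le_trans _ _ (visit_mean B M (fun T => z * z ^+ #|T :\ i|) y)).
  apply: ler_visit_mean => T; rewrite -exprS lerBlDr.
  apply: (@le_trans _ _ (z ^+ #|T :\ i|.+1)); last by rewrite lerDl.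
  rewrite ler_weXn2l // (cardsD1 i); by case: (i \in T).
rewrite visit_meanZ mulrC; apply: ler_pM => //.
- by apply: visit_mean_ge0 => [|T]; rewrite ?(leq_trans _ d8) // exprn_ge0 // (le_trans _ z1).
- by rewrite (le_trans _ z1).
- exact: le_trans (visit_mean_bound M i y) (visit_bound_on yi).
Qed.
End VisitCount.

(** * Capacity and occupied blocks *)

Lemma probability_bigcup_finType (dT : measure_display) (T : measurableType dT)
    (R : realType) (mu : probability T R) (J : finType) (F : J -> set T) :
  (forall j, measurable (F j)) -> trivIset setT F ->
  mu (\bigcup_j F j) = (\sum_j mu (F j))%E.
Proof.
move=> mF tF; rewrite measure_fin_bigcup //; last exact: finite_finset.
rewrite (fsbigE (index_enum J)) ?index_enum_uniq //; last first.
  by move=> j _; rewrite mem_index_enum.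
by apply: eq_bigl => j; rewrite classical_sets.in_setT.
Qed.

Lemma probability_setD (dT : measure_display) (T : measurableType dT) (R : realType)
    (P : probability T R) (A B : set T) : measurable A -> measurable B -> B `<=` A ->
  P (A `\` B) = (P A - P B)%E.
Proof.
move=> mA mB BA; rewrite -[in X in _ = (_ - X)%E](classical_sets.setIidr BA).
by apply: measureD => //; rewrite (le_lt_trans (probability_le1 _ _)) ?ltry.
Qed.

Lemma probability_setU_null (dT : measure_display) (T : measurableType dT)
    (R : realType) (P : probability T R) (A B C : set T) :
  measurable A -> measurable B -> measurable C -> B `<=` C -> P C = 0%E ->
  P (A `|` B) = P A.
Proof.
by move=> mA mB mC BC C0; apply: measureU0 => //; exact: subset_measure0 BC C0.
Qed.

Section Capacity.
Context {R : realType} {d : nat} {dW : measure_display} {W : measurableType dW}.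
Variables (Px : Zd d -> probability W R) (X : nat -> W -> Zd d).
Hypothesis d0 : (0 < d)%N.
Hypothesis srw : is_simple_random_walk Px X.
Implicit Types (x : Zd d) (y : nat -> Zd d) (A : {fset Zd d}).

Lemma stp_inj : injective (@stp d).
Proof.
move=> [i b] [j c] /matrixP e; move: (e ord0 i); rewrite /stp !mxE !eqxx /=.
case: (i =P j) => [<-|ij] /=; last by rewrite !mulr0 mulr1; case: b {e}.
by rewrite !mulr1; case: b {e}; case: c.
Qed.

Lemma srw_step_stp x s : srw_step R x (x + stp s) = (2 * d%:R)^-1.
Proof.
rewrite /srw_step (_ : \sum_(i < d) _ = 1) ?eqxx // (addrC x) addrK.
rewrite (bigD1 s.1) //= big1 => [|i is1]; rewrite /stp !mxE !eqxx /=.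
  by case: s => i []; rewrite /= mulr1.
by rewrite (negPf is1) mulr0 normr0.
Qed.

Definition cyl y n : set W := [set w | forall k, (k <= n)%N -> X k w = y k].
Definition avoid A n k : set W :=
  [set w | forall m, (n < m <= n + k)%N -> X m w \notin A].

Lemma measurable_cyl y n : measurable (cyl y n).
Proof.
rewrite (_ : cyl y n = \bigcap_(k in [set k | (k <= n)%N]) X k @^-1` [set y k]) //.
by apply: bigcap_measurableType => k _; exact: srw.1.
Qed.

Lemma measurable_notin A m : measurable [set w | X m w \notin A].
Proof.
rewrite (_ : [set w | _] = ~` \bigcup_(a in [set` A]) X m @^-1` [set a]).
  apply: measurableC; apply: fin_bigcup_measurable => // a _; exact: srw.1.
apply/seteqP; split => w /=; first by move=> /negP XA [a aA Xa]; apply: XA; rewrite Xa.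
by move=> XA; apply/negP => XmA; apply: XA; exists (X m w).
Qed.

Lemma measurable_avoid A n k : measurable (avoid A n k).
Proof.
rewrite (_ : avoid A n k =
  \bigcap_(m in [set m | (n < m <= n + k)%N]) [set w | X m w \notin A]) //.
by apply: bigcap_measurableType => m _; exact: measurable_notin.
Qed.

Definition cyl_prob x y n : R :=
  if y 0%N == x then \prod_(k < n) srw_step R (y k) (y k.+1) else 0.

Definition extend y n (s : 'I_d * bool) (m : nat) : Zd d :=
  if (m <= n)%N then y m else y n + stp s.

Lemma cyl_prob_extend x y n s :
  cyl_prob x (extend y n s) n.+1 = cyl_prob x y n * (2 * d%:R)^-1.
Proof.
rewrite /cyl_prob {1}/extend leq0n; case: ifP => _; last by rewrite mul0r.
rewrite big_ord_recr /= [extend _ _ _ n.+1]/extend ltnn [extend _ _ _ n]/extend leqnn.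
rewrite srw_step_stp; congr (_ * _).
by apply: eq_bigr => k _; rewrite /extend (ltn_ord k) (ltnW (ltn_ord k)).
Qed.

Lemma cyl_extend y n s w :
  cyl (extend y n s) n.+1 w <-> cyl y n w /\ X n.+1 w = y n + stp s.
Proof.
split=> [H|[H1 H2] k].
  split=> [k kn|]; first by rewrite H ?(leqW kn) // /extend kn.
  by rewrite H // /extend ltnn.
rewrite leq_eqVlt => /orP[/eqP ->|]; first by rewrite H2 /extend ltnn.
by rewrite ltnS => kn; rewrite H1 // /extend kn.
Qed.

(** The Markov property is derived from the finite-dimensional laws alone, by induction on [k]: up
    to a null set, a cylinder is the disjoint union of its 2d one-step extensions. *)
Lemma markov_avoid A x k n y :
  Px x (cyl y n `&` avoid A n k) = (cyl_prob x y n * escape A k (y n))%:E.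
Proof.
elim: k n y => [|k IH] n y.
  rewrite mulr1 (_ : avoid A n 0 = setT) ?classical_sets.setIT; first exact: srw.2.
  by apply/seteqP; split => // w _ m; rewrite addn0; lia.
pose F s := cyl (extend y n s) n.+1.
have mF s : measurable (F s) by exact: measurable_cyl.
have mA k' n' : measurable (avoid A n' k') by exact: measurable_avoid.
have mC := measurable_cyl y n.
have tF : trivIset setT F.
  apply/trivIsetP => s t _ _ st; rewrite -subset0 => w [/cyl_extend[_ e1] /cyl_extend[_]].
  by rewrite e1 => /addrI /stp_inj e; rewrite e eqxx in st.
have mUF : measurable (\bigcup_s F s) by apply: fin_bigcup_measurable.
have FC : \bigcup_s F s `<=` cyl y n by move=> w [s _ /cyl_extend[]].
(* The probabilities of the extensions already add up to that of the cylinder, so jumps to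
   non-neighbours are null. *)
have null : Px x (cyl y n `\` \bigcup_s F s) = 0%E.
  rewrite probability_setD // (probability_bigcup_finType _ mF tF).
  rewrite (eq_bigr (fun=> (cyl_prob x y n * (2 * d%:R)^-1)%:E)); last first.
    by move=> s _; rewrite -(cyl_prob_extend _ _ _ s); exact: srw.2.
  rewrite (_ : Px x (cyl y n) = (cyl_prob x y n)%:E); last exact: srw.2.
  rewrite sumEFin (_ : \sum_s _ = cyl_prob x y n) ?subee //.
  rewrite -[RHS](avg_cst (cyl_prob x y n) 0 d0) /avg mulr_sumr.
  by apply: eq_bigr => s _; rewrite mulrC.
rewrite (_ : cyl y n `&` avoid A n k.+1 =
  (\bigcup_s (F s `&` avoid A n k.+1)) `|` ((cyl y n `\` \bigcup_s F s) `&` avoid A n k.+1));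
  last first.
  rewrite -setI_bigcupl -classical_sets.setIUl; congr (_ `&` _).
  by rewrite setDUK.
have mFA s : measurable (F s `&` avoid A n k.+1) by exact: measurableI.
have mR : measurable (cyl y n `\` \bigcup_s F s) by exact: measurableD.
rewrite (probability_setU_null _ _ mR _ null); first last.
- exact: subIsetl.
- exact: measurableI.
- exact: fin_bigcup_measurable.
rewrite probability_bigcup_finType //; last first.
  apply/trivIsetP => s t _ _ st; move/trivIsetP: tF => /(_ s t I I st) Fst.
  by rewrite classical_sets.setIACA Fst classical_sets.set0I.
rewrite (eq_bigr (fun s => (cyl_prob x y n * (2 * d%:R)^-1 *
    (if y n + stp s \in A then 0 else escape A k (y n + stp s)))%:E)).
  by rewrite sumEFin -mulr_sumr mulrA.
move=> s _; have ys : extend y n s n.+1 = y n + stp s by rewrite /extend ltnn.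
case: ifPn => yA.
  rewrite mulr0 (_ : _ `&` _ = set0) ?measure0 // -subset0 => w [/cyl_extend[_ Xn] Aw].
  by have := Aw n.+1; rewrite Xn yA => /(_ _); rewrite ltnS leqnn addnS ltnS leq_addr => /(_ isT).
rewrite -(cyl_prob_extend _ _ _ s) -ys -IH; congr (Px x _).
apply/seteqP; split => w /= [/[dup] Fw /cyl_extend[_ Xn] Aw]; split=> // m.
  by move=> mn; apply: Aw; lia.
case: (ltngtP m n.+1) => mn; [lia| |by rewrite mn Xn].
by move=> mk; apply: Aw; lia.
Qed.

Lemma avoid_start A x k : Px x (avoid A 0 k) = (escape A k x)%:E.
Proof.
have mC := measurable_cyl (fun=> x) 0; have mA := measurable_avoid A 0 k.
have := markov_avoid A x k 0 (fun=> x).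
rewrite /cyl_prob eqxx big_ord0 mul1r => <-.
have C1 : Px x (cyl (fun=> x) 0) = 1%E.
  by rewrite [LHS]srw.2 eqxx big_ord0.
apply/eqP; rewrite eq_le; apply/andP; split; last first.
  by apply: le_measure; rewrite ?inE //; exact: measurableI.
have C0 : Px x (~` cyl (fun=> x) 0) = 0%E.
  by rewrite probability_setC // C1 subee.
rewrite -[X in (_ <= X)%E](@probability_setU_null _ _ _ _ _
    (~` cyl (fun=> x) 0 `&` avoid A 0 k) (~` cyl (fun=> x) 0)) //.
- by rewrite -classical_sets.setIUl setUv classical_sets.setTI.
- exact: measurableI.
- by apply: measurableI => //; exact: measurableC.
- exact: measurableC.
Qed.

(** Never returning to [A] is the decreasing limit of not returning within [k] steps. *)
Lemma capacity_cvg A : exists2 c : R, capacity Px X A = c%:E &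
  \sum_(x <- A) escape A k x @[k --> \oo] --> c.
Proof.
pose F k := avoid A 0 k.
have EF : [set w | forall n, (0 < n)%N -> X n w \notin A] = \bigcap_k F k.
  apply/seteqP; split => [w H k _ m /andP[m0 _]|w H n n0]; first exact: H.
  by apply: (H n) => //; rewrite n0 add0n leqnn.
have mF k : measurable (F k) by exact: measurable_avoid.
have cvgF x : (escape A k x)%:E @[k --> \oo] --> Px x (\bigcap_k F k).
  under eq_fun do rewrite -avoid_start.
  apply: nonincreasing_cvg_mu => //.
  - by rewrite (le_lt_trans (probability_le1 _ _)) ?ltry.
  - exact: bigcapT_measurable.
  - move=> m n mn; apply/subsetPset => w Fn k /andP[k0 km]; apply: Fn.
    by rewrite k0; lia.
exists (\sum_(x <- A) fine (Px x (\bigcap_k F k))).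
  rewrite /capacity EF -sumEFin; apply: eq_bigr => x _.
  by rewrite fineK // fin_num_measure //; exact: bigcapT_measurable.
have H : (\sum_(x <- A) escape A k x)%:E @[k --> \oo] -->
    (\sum_(x <- A) fine (Px x (\bigcap_k F k)))%:E.
  rewrite -sumEFin; under eq_fun do rewrite -sumEFin.
  apply: cvg_nnesum => x _.
    by near=> k; rewrite -avoid_start; exact: measure_ge0.
  by rewrite fineK ?fin_num_measure //; exact: bigcapT_measurable.
exact: fine_cvg H.
Unshelve. all: by end_near.
Qed.
End Capacity.

(** * Probability that all blocks of a separated family are occupied *)

Section Covering.
Context {R : realType} {d : nat} {dW : measure_display} {W : measurableType dW}.
Variables (Px : Zd d -> probability W R) (X : nat -> W -> Zd d).
Hypothesis d8 : (8 <= d)%N.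
Hypothesis srw : is_simple_random_walk Px X.
Context {dO : measure_display} {Omega : measurableType dO}.
Variables (P : probability Omega R) (Int : Omega -> set (Zd d)) (u : R).
Hypothesis u0 : 0 <= u.
Hypothesis ri : is_random_interlacement Px X u P Int.

Definition vacant (K : {fset Zd d}) : set Omega := [set o | Int o `&` [set` K] = set0].

Lemma vacantE K : vacant K = \bigcap_(x in [set` K]) ~` [set o | Int o x].
Proof.
apply/seteqP; split => o /= H; first by move=> x xK Ix; suff : set0 x by []; rewrite -H.
by apply/seteqP; split=> // x [Ix xK]; exact: H xK Ix.
Qed.

Lemma measurable_vacant K : measurable (vacant K).
Proof.
rewrite vacantE; apply: fin_bigcap_measurable => // x _; apply: measurableC.
exact: ri.1.
Qed.

Section Blocks.
Context {I : finType}.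
Variable B : I -> {fset Zd d}.

Definition vacant_on_occupied_on (J : {set I}) (s : seq I) : set Omega :=
  [set o | (forall j, j \in J -> vacant (B j) o) /\ (forall j, j \in s -> ~ vacant (B j) o)].

Lemma measurable_vacant_occupied J s : measurable (vacant_on_occupied_on J s).
Proof.
rewrite (_ : vacant_on_occupied_on J s =
  (\bigcap_(j in [set` J]) vacant (B j)) `&` (\bigcap_(j in [set` s]) ~` vacant (B j))) //.
by apply: measurableI; apply: fin_bigcap_measurable => // j _;
  [|apply: measurableC]; exact: measurable_vacant.
Qed.

Definition union_blocks (J : {set I}) : {fset Zd d} := (\bigcup_(j in J) B j)%fset.

Lemma union_blocksP J y :
  (y \in union_blocks J) = (at_blocks B y :&: J != finset.set0).
Proof.
apply/bigfcupP/finset.set0Pn => [[j /andP[_ jJ] yj]|[j]].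
  by exists j; rewrite !inE yj.
by rewrite !inE => /andP[yj jJ]; exists j => //; rewrite mem_index_enum.
Qed.

Lemma vacant_union J : vacant_on_occupied_on J [::] = vacant (union_blocks J).
Proof.
apply/seteqP; split=> o; rewrite !vacantE.
  move=> [H _] x /bigfcupP[j /andP[_ jJ] xj].
  by have := H j jJ; rewrite vacantE; apply.
move=> H; split=> // j jJ; rewrite vacantE => x xj; apply: H.
by apply/bigfcupP; exists j => //; rewrite mem_index_enum.
Qed.

(** Occupation of block [j] is the absence of a constraint minus vacancy of block [j], which is the
    recursion of [incl_excl]. *)
Lemma inclusion_exclusion s J :
  P (vacant_on_occupied_on J s) =
  (incl_excl (fun J => fine (P (vacant (union_blocks J)))) s J)%:E.
Proof.
elim: s J => [|j s IH] J /=.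
  by rewrite vacant_union fineK // fin_num_measure //; exact: measurable_vacant.
rewrite (_ : vacant_on_occupied_on J (j :: s) =
    vacant_on_occupied_on J s `\` vacant_on_occupied_on (j |: J) s).
  rewrite probability_setD ?IH ?EFinB //; [exact: measurable_vacant_occupied ..|].
  by move=> o [H1 H2]; split=> // k kJ; apply: H1; rewrite !inE kJ orbT.
apply/seteqP; split=> o [H1 H2].
  split; first by split=> // k ks; apply: H2; rewrite in_cons ks orbT.
  by move=> [H _]; apply: (H2 j); rewrite ?mem_head //; apply: H; rewrite finset.setU11.
have [H3 H4] := H1; split=> // k; rewrite in_cons => /orP[/eqP -> Bj|/H4 //].
by apply: H2; split=> // i; rewrite !inE => /orP[/eqP -> //|/H3].
Qed.

Variables (z : R) (L : nat).
Hypothesis z1 : 1 <= z.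
Hypothesis sep : forall i x, x \in B i ->
  \sum_(j | j != i) block_potential B j x <= (2 * z)^-1.
Hypothesis BL : forall i, (#|` B i| <= L)%N.

(** Intensity of a cloud of [n]-step walks, started from each lattice point at rate u/(n+1) and
    sorted by the set of blocks they visit. *)
Definition poisson_mass n : seq (R * {set I}) :=
  [seq (u / n.+1%:R * visit_mass B n T, T) | T : {set I}].

Lemma sum_poisson_mass n phi : phi finset.set0 = 0 ->
  \sum_(t <- poisson_mass n) t.1 * phi t.2 = u / n.+1%:R * sumZ (visit_mean B n phi).
Proof.
move=> p0; rewrite big_map -sum_visit_mass // mulr_sumr big_enum.
by apply: eq_bigr => T _; rewrite mulrA.
Qed.

(** By [sumZ_hits] the exponent is [u] times a Cesaro mean of the escape sums of the union of
    blocks, and these tend to its capacity. *)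
Lemma vacant_cvg J : expR (- \sum_(t <- poisson_mass n) t.1 * (t.2 :&: J != finset.set0)%:R)
  @[n --> \oo] --> fine (P (vacant (union_blocks J))).
Proof.
have d0 : (0 < d)%N by exact: leq_trans d8.
have [c cE escc] := capacity_cvg d0 srw (union_blocks J).
rewrite ri.2 cE /= -mulrN; apply: continuous_cvg; first exact: continuous_expR.
rewrite mulrN; apply: cvgN.
rewrite (_ : (fun n => _) = fun n => u * arithmetic_mean
  (fun k => \sum_(x <- union_blocks J) escape (union_blocks J) k x) n).
  by apply: cvgMr; exact: cesaro.
apply/funext => n; rewrite (sum_poisson_mass _ (hits0 J)).
rewrite (sumZ_hits d0 (union_blocksP J)) /arithmetic_mean /= /series /= big_mkord.
by rewrite -!mulrA.
Qed.

(** The n+1 steps cancel the rate 1/(n+1), so the bound is uniform in [n]; the union of the blocks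
    has at most L #|I| points, each contributing at most 2z. *)
Lemma poisson_mass_mgf n :
  \sum_(t <- poisson_mass n) t.1 * (z ^+ #|t.2| - 1) <= u * (2 * z) * L%:R * #|I|%:R.
Proof.
have d0 : (0 < d)%N by exact: leq_trans d8.
have z0 : 0 <= z by have := z1; lra.
rewrite (sum_poisson_mass _ (phi := fun T : {set I} => z ^+ #|T| - 1)) ?cards0 ?subrr //.
have p0 : z ^+ #|finset.set0 : {set I}| - 1 = 0 by rewrite cards0 subrr.
have /= H := @sumZ_visit_mean_le R d I B d0 (union_blocks finset.setT) (2 * z)
   (fun T : {set I} => z ^+ #|T| - 1) n _ p0.
apply: (@le_trans _ _ (u / n.+1%:R * (n.+1%:R * (2 * z * #|` union_blocks finset.setT|%:R)))).
  rewrite ler_wpM2l ?divr_ge0 //; apply: H.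
  - by rewrite mulr_ge0.
  - by move=> y; rewrite union_blocksP finset.setIT negbK => /eqP.
  - move=> m y; rewrite union_blocksP finset.setIT => /finset.set0Pn[i].
    by rewrite inE => yi; exact: (visit_mean_count d8 z1 sep m yi).
  - move=> m y; apply: visit_mean_ge0 => // T; rewrite subr_ge0; exact: exprn_ege1.
rewrite mulrA divfK ?pnatr_eq0 // mulrA -[leRHS]mulrA ler_wpM2l //.
  by rewrite !mulr_ge0.
rewrite -natrM ler_nat mulnC -sum_nat_const.
apply: leq_trans (_ : (\sum_(i in finset.setT) #|` B i| <= _)%N); last first.
  by rewrite big_mkcond; apply: leq_sum => i _; case: ifP.
rewrite /union_blocks; apply: (big_ind2 (fun (K : {fset Zd d}) m => #|` K| <= m)%N).
- by rewrite cardfs0.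
- by move=> K m K' m' Km Km'; rewrite (leq_trans (leq_card_fsetU K K')) ?leq_add.
- by [].
Qed.

(** The covering bound for the finite clouds is uniform in [n] and passes to the limit in the
    inclusion-exclusion formula. *)
Lemma occupied_all_le : (P (vacant_on_occupied_on finset.set0 (enum I)) <=
  ((z^-1 * expR (u * (2 * z) * L%:R)) ^+ #|I|)%:E)%E.
Proof.
rewrite inclusion_exclusion lee_fin.
pose N n (J : {set I}) :=
  expR (- \sum_(t <- poisson_mass n) t.1 * (t.2 :&: J != finset.set0)%:R).
apply: (cvgr_to_le (@incl_excl_cvg _ _ N _ (enum I) finset.set0 vacant_cvg)).
apply: nearW => n.
have mass0 : {in poisson_mass n, forall t, 0 <= t.1}.
  by move=> _ /mapP[T _ ->] /=; rewrite mulr_ge0 ?divr_ge0 ?visit_mass_ge0 ?(leq_trans _ d8).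
apply: (le_trans (incl_excl_poisson_cover mass0 z1 (enum_uniq I))).
rewrite -cardE exprMn exprVn ler_wpM2l ?invr_ge0 ?exprn_ge0 ?(le_trans _ z1) //.
by rewrite -expRM_natr ler_expR poisson_mass_mgf.
Qed.

End Blocks.
End Covering.

(** * Blocks of the plane *)

Section PlanarSum.
Context {R : realType}.

(** Off the origin, a product of two such weights dominates |p|^-4 up to a constant, and it makes
    planar sums factor. *)
Definition cauchy_weight (k : int) : R := (1 + k%:~R ^+ 2)^-1.

Lemma cauchy_weight_ge0 k : 0 <= cauchy_weight k.
Proof. by rewrite invr_ge0 addr_ge0 ?sqr_ge0. Qed.

(** Telescoping: 1 / (1 + k^2) <= 4 / ((k + 1)(k + 2)). *)
Lemma sum_cauchy_weight_nat n : \sum_(k < n) (1 + k%:R ^+ 2)^-1 <= 4 - 4 / n.+1%:R :> R.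
Proof.
elim: n => [|n IH]; first by rewrite big_ord0 divr1 subrr.
rewrite big_ord_recr /=; apply: le_trans (lerD IH (lexx _)) _.
have n0 : 0 <= n%:R :> R by [].
have [-> ->] : n.+1%:R = n%:R + 1 :> R /\ n.+2%:R = n%:R + 2 :> R.
  by rewrite -[n.+2]addn2 -[n.+1]addn1 !natrD.
set x := n%:R in n0 *.
have e : 4 - 4 / (x + 2) - (4 - 4 / (x + 1)) = 4 / ((x + 1) * (x + 2)).
  by field; apply/andP; split; lra.
have x1 : 0 < 1 + x ^+ 2 by have := sqr_ge0 x; lra.
have x2 : 0 < (x + 1) * (x + 2) by rewrite mulr_gt0; lra.
rewrite -lerBrDl e ler_pdivlMr // mulrC ler_pdivrMr //.
have [x1'|x1'] : x = 0 \/ 1 <= x.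
- by rewrite /x; case: (n) => [|m]; [left|right; rewrite -natr1 lerDr].
- by rewrite x1'; lra.
- nra.
Qed.

Definition int_range n : seq int :=
  [seq Posz k | k <- iota 0 n] ++ [seq Negz k | k <- iota 0 n].

Lemma uniq_int_range n : uniq (int_range n).
Proof.
rewrite cat_uniq !map_inj_uniq ?iota_uniq /=; [|by move=> ? ? []..].
by rewrite andbT; apply/hasPn => _ /mapP[k _ ->]; apply/mapP => -[].
Qed.

Lemma mem_int_range n k : (`|k| < n)%N -> k \in int_range n.
Proof.
move=> kn; rewrite mem_cat; apply/orP; case: k kn => k kn; [left|right];
by apply/mapP; exists k => //; rewrite mem_iota add0n //; lia.
Qed.

Lemma sum_cauchy_weight_le n : \sum_(k <- int_range n) cauchy_weight k <= 8.
Proof.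
have S4 : \sum_(k < n) (1 + k%:R ^+ 2)^-1 <= 4 :> R.
  by apply: le_trans (sum_cauchy_weight_nat n) _; rewrite gerBl divr_ge0.
rewrite big_cat !big_map -[8](_ : 4 + 4 = _); last by ring.
have -> : iota 0 n = index_iota 0 n by rewrite /index_iota subn0.
rewrite !big_mkord.
apply: lerD; first exact: S4.
apply: le_trans S4; apply: ler_sum => k _; rewrite /cauchy_weight lef_pV2 ?posrE.
- rewrite NegzE rmorphN sqrrN /= lerD2l -[X in _ <= X ^+ 2]natr1.
  have k0 : 0 <= (k : nat)%:R :> R by [].
  by nra.
- by rewrite ltr_pwDl ?sqr_ge0.
- by rewrite ltr_pwDl ?sqr_ge0.
Qed.

Lemma sum_planar_weight (s : seq (int * int)) : uniq s ->
  \sum_(p <- s) cauchy_weight p.1 * cauchy_weight p.2 <= 64.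
Proof.
move=> us.
have [n sn] : exists n, forall p, p \in s -> (`|p.1| < n /\ `|p.2| < n)%N.
  exists (\max_(p <- s) maxn `|p.1| `|p.2|).+1 => p ps.
  have : (maxn `|p.1| `|p.2| <= \max_(p <- s) maxn `|p.1| `|p.2|)%N.
    exact: (@leq_bigmax_seq _ s xpredT (fun q : int * int => maxn `|q.1| `|q.2|)%N p ps isT).
  by rewrite geq_max !ltnS => /andP[].
pose T := [seq (k, m) | k <- int_range n, m <- int_range n].
have uT : uniq T by apply: allpairs_uniq; rewrite ?uniq_int_range // => -[? ?] [? ?].
pose F (p : int * int) := cauchy_weight p.1 * cauchy_weight p.2.
have F0 p : 0 <= F p by rewrite mulr_ge0 ?cauchy_weight_ge0.
apply: (@le_trans _ _ (\sum_(p <- T) F p)).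
  rewrite (perm_big [seq p <- T | p \in s]) /=; last first.
    apply: uniq_perm; rewrite ?filter_uniq // => p; rewrite mem_filter.
    case ps : (p \in s) => //=; apply/esym/allpairsP; exists p.
    by have [? ?] := sn p ps; split; rewrite ?mem_int_range //; case: (p).
  by rewrite big_filter big_mkcond /=; apply: ler_sum => p _; case: ifP.
rewrite big_allpairs_dep /F /=.
under eq_bigr do rewrite -mulr_sumr.
rewrite -mulr_suml (_ : 64 = 8 * 8); last by ring.
by apply: ler_pM; rewrite ?sum_cauchy_weight_le // sumr_ge0 // => k _; exact: cauchy_weight_ge0.
Qed.
End PlanarSum.

Section PlaneBlocks.
Context {R : realType} {d : nat}.
Hypothesis d2 : (2 <= d)%N.
Variable l : nat.
Hypothesis l0 : (0 < l)%N.
Implicit Types p q : int * int.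

Definition block_point p (ab : 'I_l * 'I_l) : int * int :=
  (l%:Z * p.1 + ab.1%:Z, l%:Z * p.2 + ab.2%:Z).

Definition block p : {fset Zd d} :=
  [fset plane d (block_point p ab) | ab in {: 'I_l * 'I_l}]%fset.

Lemma card_block p : (#|` block p| <= l ^ 2)%N.
Proof.
rewrite (leq_trans (leq_imfset_card _ _ _)) // -cardE card_prod !card_ord.
by rewrite mulnn.
Qed.

Lemma sqnorm_plane p q :
  (p.1 - q.1)%:~R ^+ 2 + (p.2 - q.2)%:~R ^+ 2 <= sqnorm (plane d p - plane d q) :> R.
Proof.
have d0 : (0 < d)%N by exact: leq_trans d2.
rewrite /sqnorm (bigD1 (Ordinal d0)) //= (bigD1 (Ordinal d2)) //= !mxE /=.
by rewrite addrA lerDl; apply: sumr_ge0 => i _; exact: sqr_ge0.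
Qed.

Definition same_parity p q := (odd `|p.1 - q.1| == false) && (odd `|p.2 - q.2| == false).

(** An even nonzero [k] has |k| >= 2, so the offset |a - b| < m is at most half of m |k|. *)
Lemma coord_separation (k a b : int) (m : nat) : odd `|k| = false ->
  (0 <= a < m%:Z) -> (0 <= b < m%:Z) ->
  (m%:Z * k) ^+ 2 <= 4 * (m%:Z * k + (a - b)) ^+ 2.
Proof.
move=> ko am bm.
have [->|k0] := eqVneq k 0; first by rewrite mulr0 expr0n mulr_ge0 ?sqr_ge0.
have [k2|k2] : 2 <= k \/ k <= -2 by lia.
- have : 0 <= m%:Z * k - 2 * m%:Z by nia.
  nia.
- have : m%:Z * k + 2 * m%:Z <= 0 by nia.
  nia.
Qed.

(** With S = |p - q|^2, points of the two blocks are at squared distance at least l^2 S / 4, so the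
    potential is at most (128 / (l^2 S))^2. Since S >= 1, S^-2 is at most four times the product of
    the weights. *)
Lemma potential_blocks p q x y : p != q -> same_parity p q -> x \in block p -> y \in block q ->
  potential (x - y) <= 2 ^+ 16 / l%:R ^+ 4 *
    (cauchy_weight (p.1 - q.1) * cauchy_weight (p.2 - q.2)) :> R.
Proof.
move=> pq /andP[/eqP s1 /eqP s2] /imfsetP[[a b] _ ->] /imfsetP[[a' b'] _ ->] /=.
set x' := block_point p _; set y' := block_point q _.
have dist k n n' (c c' : 'I_l) : odd `|n - n' : int| = false -> k = n - n' ->
    (l%:Z * k)%:~R ^+ 2 <= 4 * ((l%:Z * n + c%:Z) - (l%:Z * n' + c'%:Z))%:~R ^+ 2 :> R.
  move=> nn' ->; rewrite -!rmorphXn /= -(intrM R 4) ler_int.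
  rewrite [X in 4 * X ^+ 2](_ : _ = l%:Z * (n - n') + (c%:Z - c'%:Z)); last by ring.
  by apply: coord_separation => //; have := ltn_ord c; have := ltn_ord c'; lia.
have D1 := dist _ _ _ a a' s1 erefl; have D2 := dist _ _ _ b b' s2 erefl.
have := @sqnorm_plane x' y'; rewrite {1 2}/x' {1 2}/y' /block_point /=.
move: D1 D2; set e1 := (_ - _)%:~R; set e2 := (_ - _)%:~R.
set N := sqnorm _; rewrite /cauchy_weight /potential -/N !rmorphM /=.
set k := (p.1 - q.1)%:~R; set m := (p.2 - q.2)%:~R; set L := l%:R => D1 D2 DN.
have S1 : 1 <= k ^+ 2 + m ^+ 2.
  rewrite /k /m -!rmorphXn -rmorphD /= -[1]/(1%:~R) ler_int.
  have : p.1 - q.1 != 0 \/ p.2 - q.2 != 0.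
    apply/orP; rewrite -negb_and !subr_eq0; apply: contra pq => /andP[/eqP e /eqP e'].
    by rewrite [p]surjective_pairing [q]surjective_pairing e e'.
  by move=> [] ?; nia.
have L0 : 1 <= L by rewrite ler1n.
have [k0 m0] : 0 <= k ^+ 2 /\ 0 <= m ^+ 2 by rewrite !sqr_ge0.
move: S1 D1 D2; rewrite !exprMn; set K := k ^+ 2 in k0 *; set M := m ^+ 2 in m0 *.
set S := K + M => S1 D1 D2.
have LS : L ^+ 2 * S <= 4 * N by rewrite /S; lra.
have L2 : 1 <= L ^+ 2 by rewrite exprn_ege1.
have L00 : 0 < L by lra.
have S0 : 0 < S by lra.
have K0 : 0 < 1 + K by lra.
have M0 : 0 < 1 + M by lra.
have LS1 : 1 <= L ^+ 2 * S by apply: mulr_ege1.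
apply: (@le_trans _ _ ((128 / (L ^+ 2 * S)) ^+ 2)).
  have N0 : 0 <= N by lra.
  rewrite -exprMn ler_pXn2r ?nnegrE ?divr_ge0 //; [|lra|lra].
  rewrite ler_pdivrMr; last by lra.
  rewrite mulrAC ler_pdivlMr; last by lra.
  lra.
rewrite (_ : (128 / (L ^+ 2 * S)) ^+ 2 = 2 ^+ 14 / L ^+ 4 * S ^- 2); last first.
  by field; rewrite (gt_eqF L00) (gt_eqF S0).
rewrite (_ : 2 ^+ 16 / _ * _ = 2 ^+ 14 / L ^+ 4 * (4 * ((1 + K)^-1 / (1 + M)))); last first.
  by field; rewrite (gt_eqF L00) (gt_eqF K0) (gt_eqF M0).
rewrite ler_wpM2l ?divr_ge0 ?exprn_ge0 //.
rewrite -invfM.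
have : 0 < (1 + K) * (1 + M) by rewrite mulr_gt0; lra.
move=> KM; rewrite ler_pdivlMr // mulrC ler_pdivrMr ?exprn_gt0 //.
rewrite (_ : 4 * S ^+ 2 = (2 * S) * (2 * S)); last by ring.
by apply: ler_pM; rewrite /S in S1 *; lra.
Qed.

(** A block has at most l^2 points, each of potential at most 2^16 / l^4 times a weight, and the
    weights sum to at most 2^6. The total 2^22 / l^2 is at most 1/(2z) by the choice of [l]. *)
Lemma block_sep (z : R) (s : seq (int * int)) : uniq s ->
  {in s &, forall p q, same_parity p q} -> 1 <= z -> 2 ^+ 23 * z <= l%:R ^+ 2 ->
  forall (i : seq_sub s) x, x \in block (ssval i) ->
  \sum_(j | j != i) block_potential (fun j : seq_sub s => block (ssval j)) j x <= (2 * z)^-1.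
Proof.
move=> us par z1 lz i x xi.
have L0 : 0 < l%:R :> R by rewrite ltr0n.
pose w (q : int * int) : R :=
  cauchy_weight ((ssval i).1 - q.1) * cauchy_weight ((ssval i).2 - q.2).
have w0 q : 0 <= w q by rewrite mulr_ge0 ?cauchy_weight_ge0.
have c0 m : 0 <= 2 ^+ 16 / l%:R ^+ m :> R by rewrite divr_ge0 ?exprn_ge0.
apply: (@le_trans _ _ (\sum_(j : seq_sub s) 2 ^+ 16 / l%:R ^+ 2 * w (ssval j))).
  rewrite big_mkcond /=; apply: ler_sum => j _; case: eqP => [_|/eqP ji].
    exact: mulr_ge0.
  rewrite /block_potential; apply: (@le_trans _ _ (\sum_(y <- block (ssval j))
     2 ^+ 16 / l%:R ^+ 4 * w (ssval j))).
    rewrite big_seq [leRHS]big_seq; apply: ler_sum => y yj.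
    apply: potential_blocks => //; last by apply: par; exact: ssvalP.
    by apply: contra ji => /eqP /val_inj ->.
  rewrite big_const_seq count_predT iter_addr_0 -[leLHS]mulr_natr.
  rewrite [leRHS](_ : _ = 2 ^+ 16 / l%:R ^+ 4 * w (ssval j) * (l ^ 2)%:R).
    by rewrite ler_wpM2l ?ler_nat ?card_block // mulr_ge0.
  by rewrite natrX; field; rewrite gt_eqF.
rewrite -mulr_sumr.
have : \sum_(j : seq_sub s) w (ssval j) <= 64.
  rewrite -(big_map (fun j : seq_sub s => ((ssval i).1 - (ssval j).1, (ssval i).2 - (ssval j).2))
    xpredT (fun p => cauchy_weight p.1 * cauchy_weight p.2)).
  apply: sum_planar_weight; rewrite map_inj_uniq ?index_enum_uniq // => j k [].
  move=> /addrI /oppr_inj e1 /addrI /oppr_inj e2; apply: val_inj => /=.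
  by rewrite [LHS]surjective_pairing [RHS]surjective_pairing e1 e2.
move=> w64; apply: (@le_trans _ _ (2 ^+ 16 / l%:R ^+ 2 * 64)).
  by rewrite ler_wpM2l.
have z0 : 0 < z by lra.
rewrite -[leRHS]mul1r ler_pdivlMr ?mulr_gt0 //.
rewrite (_ : _ * (2 * z) = 2 ^+ 23 * z / l%:R ^+ 2); last by field; rewrite gt_eqF.
by rewrite ler_pdivrMr ?exprn_gt0 // mul1r.
Qed.
End PlaneBlocks.

Definition parity (p : int * int) : bool * bool := (odd `|p.1|, odd `|p.2|).

Lemma parity_same p q : parity p = parity q -> same_parity p q.
Proof. by move=> [e1 e2]; rewrite /same_parity; apply/andP; split; lia. Qed.

Lemma parity_pigeonhole (s : seq (int * int)) :
  exists c, (size s <= 4 * size [seq p <- s | parity p == c])%N.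
Proof.
apply: contrapT => H.
have Hc c : (4 * size [seq p <- s | parity p == c] < size s)%N.
  by rewrite ltnNge; apply/negP => ?; apply: H; exists c.
have : (\sum_(c : bool * bool) size [seq p <- s | parity p == c] = size s)%N.
  rewrite -(sum1_size s) (partition_big parity xpredT) //=.
  by apply: eq_bigr => c _; rewrite size_filter sum1_count.
rewrite -(pair_bigA _ (fun a b => size [seq p <- s | parity p == (a, b)])) /=.
rewrite !big_bool /=.
have := Hc (true, true); have := Hc (true, false).
have := Hc (false, true); have := Hc (false, false); lia.
Qed.

(** * Occupation of an arbitrary finite family of planar blocks *)

Section OccupiedBlocks.
Context {R : realType} {d : nat} {dW : measure_display} {W : measurableType dW}.
Variables (Px : Zd d -> probability W R) (X : nat -> W -> Zd d).
Hypothesis d8 : (8 <= d)%N.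
Hypothesis srw : is_simple_random_walk Px X.
Context {dO : measure_display} {Omega : measurableType dO}.
Variables (P : probability Omega R) (Int : Omega -> set (Zd d)) (u : R).
Hypothesis u0 : 0 <= u.
Hypothesis ri : is_random_interlacement Px X u P Int.
Variables (l : nat) (z delta : R).
Hypothesis l0 : (0 < l)%N.
Hypothesis z1 : 1 <= z.
Hypothesis lz : 2 ^+ 23 * z <= l%:R ^+ 2.
Hypothesis delta01 : 0 <= delta <= 1.
Hypothesis cover : z^-1 * expR (u * (2 * z) * (l ^ 2)%:R) <= delta ^+ 16.

Definition occupied_blocks (s : seq (int * int)) : set Omega :=
  [set o | forall p, p \in s -> ~ vacant Int (block l p) o].

Lemma measurable_occupied_blocks s : measurable (occupied_blocks s).
Proof.
rewrite (_ : occupied_blocks s = \bigcap_(p in [set` s]) ~` vacant Int (block l p)) //.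
apply: fin_bigcap_measurable => // p _; apply: measurableC; exact: (measurable_vacant ri).
Qed.

(** The most frequent parity class keeps a quarter of [s], so delta^16 per block of the class
    becomes delta^4 per block of [s]; the contours will lose a second factor 4 in the exponent. *)
Lemma occupied_blocks_le s : uniq s -> (P (occupied_blocks s) <= ((delta ^+ 4) ^+ size s)%:E)%E.
Proof.
move=> us; have [c sc] := parity_pigeonhole s.
set s' := [seq p <- s | parity p == c] in sc.
have us' : uniq s' by exact: filter_uniq.
have par : {in s' &, forall p q, same_parity p q}.
  move=> p q; rewrite !mem_filter => /andP[/eqP pc _] /andP[/eqP qc _].
  by apply: parity_same; rewrite pc.
pose B (j : seq_sub s') := @block d l (ssval j).
have step : (P (occupied_blocks s) <=
    P (vacant_on_occupied_on Int B finset.set0 (enum {: seq_sub s'})))%E.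
  apply: le_measure; rewrite ?inE.
  - exact: measurable_occupied_blocks.
  - by have := measurable_vacant_occupied ri B finset.set0 (enum {: seq_sub s'}).
  - move=> o H; split=> [j|j _]; first by rewrite inE.
    by apply: H; have := ssvalP j; rewrite mem_filter => /andP[].
have BL j : (#|` B j| <= l ^ 2)%N by exact: card_block.
have d2 : (2 <= d)%N by exact: leq_trans d8.
have sep := block_sep d2 l0 us' par z1 lz.
apply: (le_trans step); apply: (le_trans (occupied_all_le d8 srw u0 ri z1 sep BL)).
rewrite lee_fin card_seq_sub //.
apply: (@le_trans _ _ ((delta ^+ 16) ^+ size s')).
  apply: lerXn2r => //; rewrite nnegrE.
    by rewrite mulr_ge0 ?expR_ge0 // invr_ge0 (le_trans _ z1).
  by apply: exprn_ge0; case/andP: delta01.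
case/andP: delta01 => ? ?; rewrite -!exprM ler_wiXn2l //.
by rewrite (_ : 16 = 4 * 4)%N // -mulnA leq_mul2l sc.
Qed.
End OccupiedBlocks.

(** * Contours of oriented percolation *)

(** The first boolean tells vertical from horizontal, the second is true for a negative
    orientation. *)
Notation dir := (bool * bool)%type.

Section Contour.

Definition right : dir := (false, false).
Definition up : dir := (true, false).
Definition left : dir := (false, true).
Definition down : dir := (true, true).

Definition vec (v : dir) : int * int :=
  match v with
  | (false, false) => (1, 0) | (true, false) => (0, 1)
  | (false, true) => (-1, 0) | (true, true) => (0, -1)
  end.

Definition turn_right (v : dir) : dir :=
  match v with
  | (false, false) => down | (true, false) => right
  | (false, true) => up | (true, true) => left
  end.

Definition turn_left (v : dir) : dir :=
  match v with
  | (false, false) => up | (true, false) => left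
  | (false, true) => down | (true, true) => right
  end.

(* Position of the initial corner of the side of direction [v] of a unit square, relative to
   the lower left corner of the square; sides are oriented counterclockwise. *)
Definition corner_offset (v : dir) : int * int :=
  match v with
  | (false, false) => (0, 0) | (true, false) => (1, 0)
  | (false, true) => (1, 1) | (true, true) => (0, 1)
  end.

Lemma turn_rightK : cancel turn_right turn_left.
Proof. by move=> [[] []]. Qed.

Lemma turn_leftK : cancel turn_left turn_right.
Proof. by move=> [[] []]. Qed.

Lemma vec_turn_right2 v : vec (turn_right (turn_right v)) = - vec v.
Proof. by move: v => [[] []]. Qed.

Lemma corner_turn_right v : corner_offset (turn_right v) + vec (turn_right v) = corner_offset v.
Proof. by move: v => [[] []]. Qed.

Lemma corner_turn_left v : corner_offset (turn_left v) = corner_offset v + vec v.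
Proof. by move: v => [[] []]. Qed.

Definition side := ((int * int) * dir)%type.

Definition corner (e : side) : int * int := e.1 + corner_offset e.2.

Definition across (e : side) : int * int := e.1 + vec (turn_right e.2).

Variable W : int * int -> bool.

Definition boundary (e : side) : bool := W e.1 && ~~ W (across e).

(* Where two squares of [W] meet only at a corner, the contour turns right and passes from
   one to the other; this convention makes [next_side] injective on the boundary. *)
Definition next_side (e : side) : side :=
  let: (w, v) := e in
  if W (w + vec v + vec (turn_right v)) then (w + vec v + vec (turn_right v), turn_right v)
  else if W (w + vec v) then (w + vec v, v) else (w, turn_left v).

Lemma next_boundary e : boundary e -> boundary (next_side e).
Proof.
case: e => w v /andP[/= Ww Wn]; rewrite /next_side /boundary /across.
case: ifPn => [Wb|Wb] /=; first by rewrite Wb vec_turn_right2 addrAC addrK.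
case: ifPn => [Wa|Wa] /=; first by rewrite Wa.
by rewrite Ww turn_leftK.
Qed.

Lemma corner_next e : corner (next_side e) = corner e + vec e.2.
Proof.
case: e => w v; rewrite /next_side /corner; case: ifP => _ /=.
  by rewrite -addrA [vec (turn_right v) + _]addrC corner_turn_right addrAC.
case: ifP => _ /=; first by rewrite addrAC.
by rewrite corner_turn_left addrA.
Qed.

(** If both successors arise from the same kind of turn, the side is recovered by undoing it.
    Different kinds of turn would put one square both inside and outside [W]. *)
Lemma next_inj e e' : boundary e -> boundary e' -> next_side e = next_side e' -> e = e'.
Proof.
have mixRS w v w' : W w -> ~~ W (w' + vec (turn_right (turn_right v))) ->
    w + vec v = w' -> False.
  by move=> Ww Wn ww'; rewrite -ww' vec_turn_right2 addrK Ww in Wn.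
have mixRL w v w' : W w -> w + vec v + vec (turn_right v) = w' ->
  ~~ W (w' + vec (turn_right (turn_right v)) +
        vec (turn_right (turn_right (turn_right v)))) -> False.
  move=> Ww <-; rewrite !vec_turn_right2 -[_ - _ - _]addrA -opprD -[w + _ + _]addrA.
  by rewrite addrK Ww.
case: e e' => w v [w' v'] /andP[/= Ww Wn] /andP[/= Ww' Wn'].
rewrite /across /= in Wn Wn'; rewrite /next_side.
have flip (u u' : dir) : u = turn_left u' -> u' = turn_right u.
  by move=> ->; rewrite turn_leftK.
case: ifPn => [Wb|Wb]; [|case: ifPn => [Wa|Wa]];
  (case: ifPn => [Wb'|Wb']; [|case: ifPn => [Wa'|Wa']]); move=> /pair_equal_spec[e1 e2].
- have vv := can_inj turn_rightK e2.
  by move: e1; rewrite vv => /addIr /addIr ->.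
- exfalso; rewrite -e2 in e1 Wn'.
  by apply: (mixRS _ _ _ Ww Wn'); apply/(addIr (vec (turn_right v))).
- exfalso; rewrite (flip _ _ e2) in Wb'.
  exact: (mixRL _ _ _ Ww e1 Wb').
- exfalso; rewrite e2 in e1 Wn.
  by apply: (mixRS _ _ _ Ww' Wn); apply/(addIr (vec (turn_right v'))).
- by move: e1; rewrite e2 => /addIr ->.
- exfalso; rewrite (flip _ _ e2) in Wn'.
  exact: (mixRS _ _ _ Ww Wn' e1).
- exfalso; rewrite (flip _ _ (esym e2)) in Wb.
  exact: (mixRL _ _ _ Ww' (esym e1) Wb).
- exfalso; rewrite (flip _ _ (esym e2)) in Wn.
  exact: (mixRS _ _ _ Ww' Wn (esym e1)).
- by rewrite e1 (can_inj turn_leftK e2).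
Qed.

End Contour.

Section Cells.

Definition prefix_corner (t : seq dir) (i : nat) : int * int := \sum_(v <- take i t) vec v.

(* The squares across the upward, respectively leftward, sides of a contour that starts at
   the origin and follows the directions [t]. *)
Definition cells (b : bool) (t : seq dir) : seq (int * int) :=
  [seq prefix_corner t i + (if b then 0 else vec left)
     | i <- iota 0 (size t) & nth right t i == (if b then up else left)].

Lemma size_cells b t : size (cells b t) = count_mem (if b then up else left) t.
Proof.
rewrite size_map size_filter -[in RHS](mkseq_nth right t) /mkseq count_map.
exact: eq_count.
Qed.

Lemma sum_vec (t : seq dir) : \sum_(v <- t) vec v =
  ((count_mem right t)%:Z - (count_mem left t)%:Z,
   (count_mem up t)%:Z - (count_mem down t)%:Z).
Proof.
elim: t => [|v t IH]; first by rewrite big_nil.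
have count v' : count_mem v' (v :: t) = ((v == v') + count_mem v' t)%N by [].
rewrite big_cons IH !count; move: (count_mem right t) (count_mem left t).
move: (count_mem up t) (count_mem down t) => u d l r.
by case: v {count} => [[] []]; congr (_, _) => /=; lia.
Qed.

Lemma size_dir (t : seq dir) : size t =
  (count_mem right t + count_mem left t + (count_mem up t + count_mem down t))%N.
Proof.
elim: t => [//|v t IH].
have count v' : count_mem v' (v :: t) = ((v == v') + count_mem v' t)%N by [].
rewrite !count [size (v :: t)]/= IH; move: (count_mem right t) (count_mem left t).
move: (count_mem up t) (count_mem down t) => u d l r.
by case: v {count} => [[] []] /=; lia.
Qed.

(* Only upward and leftward sides have a closed square across them; in a closed contour they
   make up half of the sides. *)
Lemma closed_size (t : seq dir) : prefix_corner t (size t) = 0 ->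
  exists b, (size t <= 4 * size (cells b t))%N.
Proof.
rewrite /prefix_corner take_size sum_vec => e.
have e1 : (count_mem right t)%:Z - (count_mem left t)%:Z = 0 := congr1 fst e.
have e2 : (count_mem up t)%:Z - (count_mem down t)%:Z = 0 := congr1 snd e.
have [le|le] := leqP (count_mem left t) (count_mem up t);
  [exists true|exists false]; rewrite size_cells (size_dir t) {e}; move: e1 e2 le;
  move: (count_mem right t) (count_mem left t) (count_mem up t) (count_mem down t);
  lia.
Qed.
End Cells.

(** * The contour of the set of wet squares *)

Section Percolation.
Variable G : int * int -> Prop.

Inductive wet : int * int -> Prop :=
| wet_origin : wet 0
| wet_right p : wet p -> G (p + vec right) -> wet (p + vec right)
| wet_up p : wet p -> G (p + vec up) -> wet (p + vec up).

Lemma wet_ge0 p : wet p -> 0 <= p.1 /\ 0 <= p.2.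
Proof. by elim=> [//|q _ [? ?] _|q _ [? ?] _] /=; split; lia. Qed.

Let W p : bool := `[< wet p >].

Definition wet_box (T : nat) : seq (int * int) :=
  [seq (Posz i, Posz j) | i <- iota 0 T, j <- iota 0 T].

Definition side_box (T : nat) : seq side := [seq (p, v) | p <- wet_box T, v <- enum {: dir}].

Variable T : nat.
Hypothesis bounded : forall p, wet p -> p.1 + p.2 < T%:Z.

Lemma boundary_side_box e : boundary W e -> e \in side_box T.
Proof.
case: e => [[i j] v] /andP[/asboolP /= Wp _].
have [/= i0 j0] := wet_ge0 Wp; have /= ij := bounded Wp.
apply/allpairsP; exists ((i, j), v); split => //=; last by rewrite mem_enum.
by apply/allpairsP; exists (absz i, absz j); split; rewrite /= ?mem_iota ?gez0_abs //; lia.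
Qed.

Definition first_side : side := (0, right).

Lemma boundary_first : boundary W first_side.
Proof.
apply/andP; split; first by apply/asboolP; exact: wet_origin.
by apply/asboolP => /wet_ge0[].
Qed.

Lemma boundary_iter i : boundary W (iter i (next_side W) first_side).
Proof. by elim: i => [|i IH]; [exact: boundary_first|exact: next_boundary]. Qed.

(** The boundary sides form a finite set on which [next_side] is injective, so the orbit of
    [first_side] is a cycle. *)
Lemma contour_cycle : exists n, [/\ (0 < n <= #|{: seq_sub (side_box T)}|)%N,
  iter n (next_side W) first_side = first_side &
  forall i j, (i < n)%N -> (j < n)%N ->
    iter i (next_side W) first_side = iter j (next_side W) first_side -> i = j].
Proof.
(* Extended by the identity off the boundary, [next_side] becomes a permutation of a finite type. *)
pose f (e : seq_sub (side_box T)) : seq_sub (side_box T) :=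
  if boundary W (ssval e) then insubd e (next_side W (ssval e)) else e.
have fE e : boundary W (ssval e) -> ssval (f e) = next_side W (ssval e).
  move=> be; rewrite /f be [LHS]val_insubd ifT //.
  exact/boundary_side_box/next_boundary.
have fN e : ~~ boundary W (ssval e) -> f e = e by rewrite /f => /negbTE ->.
have f_inj : injective f.
  move=> e e'; have [be|be] := boolP (boundary W (ssval e));
    have [be'|be'] := boolP (boundary W (ssval e')) => ee'.
  - apply: val_inj; apply: (next_inj be be').
    by rewrite -(fE e be) -(fE e' be') ee'.
  - by move: (be'); rewrite -{1}(fN _ be') -ee' fE // next_boundary.
  - by move: (be); rewrite -{1}(fN _ be) ee' fE // next_boundary.
  - by rewrite -[LHS](fN _ be) ee' fN.
pose x0 := SeqSub (boundary_side_box boundary_first).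
have fI i : ssval (iter i f x0) = iter i (next_side W) first_side.
  by elim: i => [//|i IH]; rewrite /= fE IH ?boundary_iter.
exists (order f x0); split; first by rewrite order_gt0 max_card.
  by rewrite -fI iter_order.
move=> i j ilt jlt; rewrite -!fI => /val_inj ij.
by rewrite -(findex_iter ilt) ij findex_iter.
Qed.

Definition contour_word n : seq dir :=
  [seq (iter i (next_side W) first_side).2 | i <- iota 0 n].

Lemma corner_iter n i : (i <= n)%N ->
  corner (iter i (next_side W) first_side) = prefix_corner (contour_word n) i.
Proof.
elim: i => [|i IH] lein.
  by rewrite /prefix_corner take0 big_nil /corner addr0.
rewrite /= corner_next IH ?(ltnW lein) // /prefix_corner (take_nth right).
  by rewrite -cats1 big_cat big_seq1 (nth_map 0%N) ?size_iota // nth_iota.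
by rewrite size_map size_iota.
Qed.

Lemma across_iter b n i : (i < n)%N -> nth right (contour_word n) i == (if b then up else left) ->
  across (iter i (next_side W) first_side) =
  prefix_corner (contour_word n) i + (if b then 0 else vec left).
Proof.
move=> lt_in; rewrite (nth_map 0%N) ?size_iota // nth_iota // -(corner_iter (ltnW lt_in)).
rewrite add0n /across /corner; case: (iter _ _ _) => w v /= /eqP ->.
by case: b; rewrite /= -addrA; congr (_ + _).
Qed.

(** The square across an upward side is the right neighbour of a wet square, and across a leftward
    side the upper one; if it were good it would be wet. *)
Lemma across_closed b e : boundary W e -> e.2 = (if b then up else left) -> ~ G (across e).
Proof.
case: e => w v /andP[/asboolP /= Ww /asboolP Wn] vb Gn; apply: Wn; move: Gn.
by rewrite /across /= vb; case: b {vb} => /=; [exact: wet_right|exact: wet_up].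
Qed.

(** A side is determined by its direction and the square across it, so sides of one direction yield
    distinct cells. The cells depend on the word [t] only, which prepares a union bound over
    words. *)
Lemma contour : exists n (t : n.-tuple dir) b,
  [/\ (0 < n <= #|{: seq_sub (side_box T)}|)%N, (n <= 4 * size (cells b t))%N,
      uniq (cells b t) & forall p, p \in cells b t -> ~ G p].
Proof.
have [n [n_bd cyc inj]] := contour_cycle.
have sz : size (contour_word n) == n by rewrite size_map size_iota.
exists n, (Tuple sz).
have [|b szb] := @closed_size (contour_word n).
  by rewrite (eqP sz) -corner_iter // cyc.
have szE : size (contour_word n) = n := eqP sz.
have cellE i : (i < n)%N -> nth right (contour_word n) i == (if b then up else left) ->
    prefix_corner (contour_word n) i + (if b then 0 else vec left) =
    across (iter i (next_side W) first_side) by move=> *; rewrite (@across_iter b n).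
have dirE i : (i < n)%N -> nth right (contour_word n) i == (if b then up else left) ->
    (iter i (next_side W) first_side).2 = (if b then up else left).
  by move=> lt_in /eqP <-; rewrite (nth_map 0%N) ?size_iota // nth_iota.
exists b; split => //; first by rewrite -{1}szE.
  rewrite map_inj_in_uniq ?filter_uniq ?iota_uniq // => i j.
  rewrite !mem_filter !mem_iota add0n /= szE => /andP[di lt_in] /andP[dj lt_jn].
  rewrite (cellE i) // (cellE j) // => eij; apply: inj => //.
  have {}di := dirE i lt_in di; have {}dj := dirE j lt_jn dj.
  move: eij di dj; case: (iter i _ _) => w v; case: (iter j _ _) => w' v'.
  by rewrite /across /= => e e1 e2; rewrite e1 e2 in e *; rewrite (addIr _ e).
move=> p /mapP[i]; rewrite mem_filter mem_iota add0n /= szE => /andP[di lt_in] ->.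
by rewrite cellE //; apply: (across_closed (boundary_iter i)); exact: dirE.
Qed.
End Percolation.

(** * Oriented paths *)

Section OrientedPaths.
Variable V : int * int -> Prop.

Fixpoint path_from (n : nat) (p : int * int) : Prop :=
  V p /\ if n is m.+1 then path_from m (p + vec right) \/ path_from m (p + vec up) else True.

Lemma path_from_head n p : path_from n p -> V p.
Proof. by case: n => [|n] []. Qed.

Lemma path_fromS n p : path_from n.+1 p -> path_from n p.
Proof.
elim: n p => [|n IH] p [Vp H]; first by split.
by split => //; case: H => /IH; [left|right].
Qed.

Lemma path_from_le m n p : (m <= n)%N -> path_from n p -> path_from m p.
Proof. by move/subnK <-; elim: (n - m)%N => [//|k IH] /path_fromS. Qed.

Lemma path_from_run v n p l : v = right \/ v = up ->
  (forall k, (k < l)%N -> V (p + vec v *+ k)) -> path_from n (p + vec v *+ l) ->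
  path_from (n + l) p.
Proof.
move=> v2; elim: l p => [|l IH] p Vp H; first by rewrite addn0; rewrite addr0 in H.
rewrite addnS; split; first by have := Vp 0%N isT; rewrite addr0.
have {}IH : path_from (n + l) (p + vec v).
  by apply: IH => [k kl|]; rewrite -addrA -mulrS //; exact: (Vp k.+1).
by case: v2 IH => ->; [left|right].
Qed.

(** Koenig's lemma for a binary tree: a point that starts paths of every length has a successor that
    does. *)
Lemma path_from_infinite p : (forall n, path_from n p) ->
  exists f, [/\ f 0%N = p, oriented_paths f & forall n, V (f n)].
Proof.
pose inf q := forall n, path_from n q.
have next q : inf q -> exists2 v, v = right \/ v = up & inf (q + vec v).
  move=> iq; have [ir|nr] := pselect (inf (q + vec right)); first by exists right; [left|].
  exists up; first by right.
  (* If length [m] fails to the right, every path long enough must begin upwards. *)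
  move/existsNP: nr => [m nm] n; have [_ /= [H|H]] := iq (maxn m n).+1.
    by case: nm; apply: path_from_le H; exact: leq_maxl.
  by apply: path_from_le H; exact: leq_maxr.
pose step q := if pselect (inf (q + vec right)) then q + vec right else q + vec up.
move=> ip; exists (fun n => iter n step p).
have inf_iter n : inf (iter n step p).
  elim: n => [//|n IH] /=; rewrite /step; case: pselect => // nr.
  by have [v [->|->]] := next _ IH.
split=> // n; last exact: path_from_head (inf_iter n 0%N).
rewrite /= /step; case: pselect => ?; [right|left]; by rewrite addrAC subrr add0r.
Qed.

Lemma oriented_path_from f k n : oriented_paths f -> (forall m, V (f m)) -> path_from n (f k).
Proof.
move=> fo Vf; elim: n k => [|n IH] k; split => //; have Hk := IH k.+1.
have /= [e|e] := fo k; [right|left].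
  by rewrite (_ : _ + _ = f k.+1) // -[RHS](subrK (f k)) e addrC.
by rewrite (_ : _ + _ = f k.+1) // -[RHS](subrK (f k)) e addrC.
Qed.
End OrientedPaths.

(** The right-hand side involves only finite horizons and countable operations, which gives
    measurability. *)
Lemma oriented_pathP (V : int * int -> Prop) :
  (exists2 f, oriented_paths f & forall n, V (f n)) <->
  exists p, forall n, path_from V n p.
Proof.
split=> [[f fo Vf]|[p /path_from_infinite[f [_ fo Vf]]]]; last by exists f.
by exists (f 0%N) => n; exact: oriented_path_from.
Qed.

(** * From oriented paths of blocks to oriented paths of points *)

Section Coarse.
Variables (V : int * int -> Prop) (l : nat).
Hypothesis l0 : (0 < l)%N.

Definition good_block (p : int * int) : Prop :=
  forall ab : 'I_l * 'I_l, V (block_point p ab).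

Lemma pair_mulrn (a b : int) k : (a, b) *+ k = (a *+ k, b *+ k).
Proof. by elim: k => [//|k IH]; rewrite !mulrS IH. Qed.

Lemma good_block_run v p k : v = right \/ v = up -> good_block p -> (k < l)%N ->
  V ((l%:Z * p.1, l%:Z * p.2) + vec v *+ k).
Proof.
move=> v2 gp kl.
have [ab <-] : exists ab : 'I_l * 'I_l,
    block_point p ab = (l%:Z * p.1, l%:Z * p.2) + vec v *+ k.
  case: v2 => ->; rewrite pair_mulrn /block_point.
    by exists (Ordinal kl, Ordinal l0); congr (_, _) => /=; rewrite ?mul0rn // natz.
  by exists (Ordinal l0, Ordinal kl); congr (_, _) => /=; rewrite ?mul0rn // natz.
exact: gp.
Qed.

Lemma next_block_corner v p : v = right \/ v = up ->
  (l%:Z * (p + vec v).1, l%:Z * (p + vec v).2) = (l%:Z * p.1, l%:Z * p.2) + vec v *+ l.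
Proof.
by case=> ->; rewrite pair_mulrn; congr (_, _) => /=; rewrite mulrDr ?mulr1 ?mulr0 ?mul0rn ?natz.
Qed.

(** A coarse step is realised by running [l] points along the bottom row or the left column of a
    good block, to the lower left corner of the next. Goodness is carried through the induction
    because [wet] does not assert it at the origin. *)
Lemma wet_path p : good_block 0 -> wet good_block p -> good_block p /\ forall n,
  path_from V n (l%:Z * p.1, l%:Z * p.2) -> path_from V (n + l * absz (p.1 + p.2)) 0.
Proof.
move=> g0.
have step v q : v = right \/ v = up -> wet good_block q ->
    (good_block q /\ forall n, path_from V n (l%:Z * q.1, l%:Z * q.2) ->
       path_from V (n + l * absz (q.1 + q.2)) 0) ->
    forall n, path_from V n (l%:Z * (q + vec v).1, l%:Z * (q + vec v).2) ->
       path_from V (n + l * absz ((q + vec v).1 + (q + vec v).2)) 0.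
  move=> v2 wq [gq IH] n; rewrite next_block_corner // => H.
  have {H}/IH : path_from V (n + l) (l%:Z * q.1, l%:Z * q.2).
    by apply: (path_from_run v2) H => k kl; exact: good_block_run.
  have [q1 q2] := wet_ge0 wq.
  rewrite -addnA -mulnS (_ : (absz (q.1 + q.2)).+1 = absz ((q + vec v).1 + (q + vec v).2)) //.
  by case: v2 => -> /=; lia.
elim=> [|q wq IH gq|q wq IH gq]; split=> //.
- move=> n; rewrite (_ : (l%:Z * _, _) = 0 :> (int * int)%type); last first.
    by congr (_, _); rewrite mulr0.
  by rewrite (_ : absz _ = 0%N) // muln0 addn0.
- by apply: step => //; left.
- by apply: step => //; right.
Qed.

Lemma wet_path_from p (T : nat) : good_block 0 -> wet good_block p -> T%:Z <= p.1 + p.2 ->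
  path_from V T 0.
Proof.
move=> g0 wp Tp; have [gp /(_ 0%N) H] := wet_path g0 wp.
apply: (@path_from_le _ T (0 + l * absz (p.1 + p.2))).
  rewrite add0n (leq_trans _ (leq_pmull _ l0)) //; lia.
apply: H; split=> //; rewrite -[X in V X](_ : block_point p (Ordinal l0, Ordinal l0) = _) //.
by rewrite /block_point /= !addr0.
Qed.

Lemma good_origin_contour (T : nat) : good_block 0 -> ~ path_from V T 0 ->
  exists n (t : n.-tuple dir) b,
  [/\ (0 < n <= #|{: seq_sub (side_box T)}|)%N, (n <= 4 * size (cells b t))%N,
      uniq (cells b t) & forall p, p \in cells b t -> ~ good_block p].
Proof.
move=> g0 npath; apply: contour => p wp; rewrite ltNge; apply/negP => Tp.
by apply: npath; exact: wet_path_from wp Tp.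
Qed.
End Coarse.

Lemma probability_bigsetU_le (dT : measure_display) (T : measurableType dT)
    (R : realType) (P : probability T R) (J : Type) (r : seq J) (F : J -> set T) (c : J -> R) :
  (forall j, measurable (F j)) -> (forall j, (P (F j) <= (c j)%:E)%E) ->
  measurable (\big[setU/set0]_(j <- r) F j) /\
  (P (\big[setU/set0]_(j <- r) F j) <= (\sum_(j <- r) c j)%:E)%E.
Proof.
move=> mF Fc; elim: r => [|j r [mr IH]]; first by rewrite !big_nil measure0.
rewrite !big_cons; split; first exact: measurableU.
have step : (P (F j `|` \big[setU/set0]_(j0 <- r) F j0) <=
    P (F j) + P (\big[setU/set0]_(j0 <- r) F j0))%E by exact: measureU2.
by apply: (le_trans step); rewrite EFinD; exact: leeD.
Qed.

Lemma mem_bigsetU (T : Type) (J : eqType) (r : seq J) (F : J -> set T) j x :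
  j \in r -> F j x -> (\big[setU/set0]_(j <- r) F j) x.
Proof.
elim: r => [//|k r IH]; rewrite in_cons big_cons => /orP[/eqP <-|jr] Fx; first by left.
by right; exact: IH.
Qed.

(** * The Peierls argument *)

Section Percolates.
Context {R : realType} {d : nat} {dW : measure_display} {W : measurableType dW}.
Variables (Px : Zd d -> probability W R) (X : nat -> W -> Zd d).
Hypothesis d8 : (8 <= d)%N.
Hypothesis srw : is_simple_random_walk Px X.
Context {dO : measure_display} {Omega : measurableType dO}.
Variables (P : probability Omega R) (Int : Omega -> set (Zd d)) (u : R).
Hypothesis u0 : 0 <= u.
Hypothesis ri : is_random_interlacement Px X u P Int.

Definition vacant_at (o : Omega) (p : int * int) : Prop := vacant_set Int o (plane d p).

Definition path_event (n : nat) (p : int * int) : set Omega :=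
  [set o | path_from (vacant_at o) n p].

Lemma measurable_path_event n p : measurable (path_event n p).
Proof.
have mV q : measurable [set o | vacant_at o q].
  rewrite (_ : [set o | _] = ~` [set o | Int o (plane d q)]) //.
  by apply: measurableC; exact: ri.1.
elim: n p => [|n IH] p.
  by rewrite (_ : path_event 0 p = [set o | vacant_at o p]) //; apply/seteqP; split=> o => [[]|].
rewrite (_ : path_event n.+1 p = [set o | vacant_at o p] `&`
  (path_event n (p + vec right) `|` path_event n (p + vec up))) //.
by apply: measurableI => //; exact: measurableU.
Qed.

Lemma path_eventE :
  [set o | exists2 f, oriented_paths f & forall n, vacant_set Int o (plane d (f n))] =
  \bigcup_p \bigcap_n path_event n p.
Proof.
apply/seteqP; split=> o.
  move=> /(oriented_pathP (vacant_at o))[p H]. by exists p => // n _; exact: H.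
by move=> [p _ H]; apply/(oriented_pathP (vacant_at o)); exists p => n; exact: H.
Qed.

Variables (l : nat) (z : R).
Hypothesis l0 : (0 < l)%N.
Hypothesis z1 : 1 <= z.
Hypothesis lz : 2 ^+ 23 * z <= l%:R ^+ 2.
Hypothesis cover : z^-1 * expR (u * (2 * z) * (l ^ 2)%:R) <= 64^-1 ^+ 16.

Lemma inv64_itv : 0 <= (64^-1 : R) <= 1.
Proof. by apply/andP; split; lra. Qed.

(** Words with too few cells or with repeated cells do not arise from contours and get the empty
    event. *)
Definition contour_event (n : nat) (tb : n.-tuple dir * bool) : set Omega :=
  if [&& (0 < n)%N, (n <= 4 * size (cells tb.2 tb.1))%N & uniq (cells tb.2 tb.1)]
  then occupied_blocks Int l (cells tb.2 tb.1) else set0.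

(** There are at least n/4 distinct occupied cells, each contributing a factor 64^-4. *)
Lemma contour_event_le n tb : (P (@contour_event n tb) <=
  (if (0 < n)%N then 64^-1 ^+ n else 0)%:E)%E.
Proof.
rewrite /contour_event; case: ifPn => [/and3P[n0 sz un]|_]; last first.
  by rewrite measure0 lee_fin; case: ifP => // _; rewrite exprn_ge0 // invr_ge0.
apply: (le_trans (occupied_blocks_le d8 srw u0 ri l0 z1 lz inv64_itv cover un)).
by rewrite n0 lee_fin -exprM; case/andP: inv64_itv => ? ?; exact: ler_wiXn2l.
Qed.

Lemma measurable_contour_event n tb : measurable (@contour_event n tb).
Proof.
rewrite /contour_event; case: ifP => _; last exact: measurable0.
by have := measurable_occupied_blocks ri l (cells tb.2 tb.1).
Qed.

(** There are 2 4^n pairs of a word and a direction, so length [n] contributes 2 16^-n, and n = 0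
    contributes nothing. *)
Lemma sum_contour_le N : \sum_(n < N)
  \sum_(tb <- enum {: n.-tuple dir * bool}) (if (0 < n)%N then 64^-1 ^+ n else 0) <= 2 / 15 :> R.
Proof.
(* The induction needs the exact partial sum; as the term n = 0 vanishes, only N - 1 terms
   remain. *)
apply: (@le_trans _ _ (2 / 15 * (1 - 16^-1 ^+ N.-1))); last first.
  by rewrite ler_piMr // gerBl exprn_ge0.
case: N => [|N]; first by rewrite big_ord0 subrr mulr0.
rewrite big_ord_recl /= big1 // add0r.
elim: N => [|N IH]; first by rewrite big_ord0 subrr mulr0.
rewrite big_ord_recr /=; apply: le_trans (lerD IH (lexx _)) _.
rewrite big_const_seq count_predT -cardE card_prod card_tuple card_prod card_bool iter_addr_0.
rewrite -[X in _ + X]mulr_natr natrM natrX mulrA -exprMn.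
rewrite (_ : 64^-1 * 4%:R = 16^-1); last by field.
rewrite /bump /= add1n [in leRHS]exprS exprS; set y := 16^-1 ^+ N.
lra.
Qed.

Definition origin : int * int := 0.

(** The lengths of the contours are bounded in terms of [T], but the sum of their probabilities is
    not affected: failure has probability at most 64^-4 + 2/15 < 1/2 for every [T]. *)
Lemma path_event_ge (T : nat) : (2^-1%:E <= P (path_event T origin))%E.
Proof.
pose N := #|{: seq_sub (side_box T)}|.+1.
pose H (n : 'I_N) := \big[setU/set0]_(tb <- enum {: n.-tuple dir * bool}) contour_event tb.
have HP n := probability_bigsetU_le (enum {: n.-tuple dir * bool})
  (@measurable_contour_event n) (@contour_event_le n).
have [mU PU] := probability_bigsetU_le (F := H) (index_enum 'I_N)
  (fun n : 'I_N => (HP n).1) (fun n : 'I_N => (HP n).2).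
have mA := measurable_path_event T origin.
have mO := measurable_occupied_blocks ri l [:: origin].
set U := \big[setU/set0]_(n <- _) _ in mU PU.
have cover_compl : ~` path_event T origin `<=` occupied_blocks Int l [:: origin] `|` U.
  move=> o npath; have [g0|ng0] := pselect (good_block (vacant_at o) l origin); last first.
    left => p; rewrite inE => /eqP -> v0; apply: ng0 => ab Iab.
    suff : set0 (plane d (block_point origin ab)) by [].
    by rewrite -v0; split=> //=; apply/imfsetP; exists ab.
  right; have [n [t [b [/andP[n0 nN] sz un ng]]]] := good_origin_contour l0 g0 npath.
  apply: (@mem_bigsetU _ _ _ _ (Ordinal (nN : (n < N)%N))); first exact: mem_index_enum.
  apply: (@mem_bigsetU _ _ _ _ (t, b)); first by rewrite mem_enum.
  rewrite /contour_event /= n0 sz un /= => p pc vp; apply: (ng p pc) => ab Iab.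
  suff : set0 (plane d (block_point p ab)) by [].
  by rewrite -vp; split=> //=; apply/imfsetP; exists ab.
have origin_le := occupied_blocks_le d8 srw u0 ri l0 z1 lz inv64_itv cover
  (isT : uniq [:: origin]).
have compl_le : (P (~` path_event T origin) <= ((64^-1 ^+ 4) ^+ 1 + 2 / 15)%:E)%E.
  have : (P (~` path_event T origin) <= P (occupied_blocks Int l [:: origin] `|` U))%E.
    by apply: le_measure; rewrite ?inE //; [exact: measurableC|exact: measurableU].
  move/le_trans; apply.
  have : (P (occupied_blocks Int l [:: origin] `|` U) <=
      P (occupied_blocks Int l [:: origin]) + P U)%E by exact: measureU2.
  move/le_trans; apply; rewrite EFinD; apply: leeD => //.
  by apply: (le_trans PU); rewrite lee_fin; exact: sum_contour_le.
rewrite -[path_event T origin]setCK probability_setC; last exact: measurableC.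
have cfin : P (~` path_event T origin) \is a fin_num.
  exact: fin_num_measure (measurableC mA).
move: compl_le; rewrite -(fineK cfin); move: (fine _) => r.
rewrite lee_fin => rle; rewrite -EFinB lee_fin.
have d4 : 64^-1 ^+ 4 <= 64^-1 :> R.
  by case/andP: inv64_itv => ? ?; rewrite -[leRHS]expr1; exact: ler_wiXn2l.
move: rle; rewrite expr1; lra.
Qed.

Lemma percolates : let E := [set o | exists2 f, oriented_paths f &
    forall n, vacant_set Int o (plane d (f n))] in measurable E /\ (0 < P E)%E.
Proof.
move=> E; rewrite /E path_eventE.
have mI p : measurable (\bigcap_n path_event n p).
  by apply: bigcapT_measurable => n; exact: measurable_path_event.
have mE : measurable (\bigcup_p \bigcap_n path_event n p).
  by apply: countable_bigcupT_measurable => //; exact: countableP.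
split=> //; apply: (@lt_le_trans _ _ (2^-1%:E)); first by rewrite lte_fin.
have lim : P (path_event n origin) @[n --> \oo] --> P (\bigcap_n path_event n origin).
  apply: (@nonincreasing_cvg_mu _ _ _ P (path_event ^~ origin)) => //.
  - by rewrite (le_lt_trans (probability_le1 _ _)) ?ltry //; exact: measurable_path_event.
  - by move=> n; exact: measurable_path_event.
  - by move=> m n mn; apply/subsetPset => o; exact: path_from_le.
have half : (2^-1%:E <= P (\bigcap_n path_event n origin))%E.
  by apply: (cvge_to_ge lim); apply: nearW => n; exact: path_event_ge.
apply: (le_trans half); apply: le_measure; rewrite ?inE //.
exact: (@bigcup_sup _ _ origin).
Qed.
End Percolates.

Theorem mainTheorem5 (R : realType) (d : nat) (hd : (13 < d)%N) :
  exists2 u0 : R, 0 < u0 &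
    forall u : R, 0 <= u -> u < u0 ->
    forall (dW : measure_display) (W : measurableType dW)
      (Px : Zd d -> probability W R) (X : nat -> W -> Zd d),
      is_simple_random_walk Px X ->
    forall (dO : measure_display) (Omega : measurableType dO)
      (P : probability Omega R) (I : Omega -> set (Zd d)),
      is_random_interlacement Px X u P I ->
    let E := [set o | exists2 f, oriented_paths f &
                        forall n, vacant_set I o (plane d (f n))] in
    measurable E /\ (0 < P E)%E.
Proof.
have d8 : (8 <= d)%N by apply: leq_trans hd.
pose q : R := 64 ^+ 16.
have q1 : 1 <= q by rewrite exprn_ege1 // ler1n.
(* The target 64^-16 is that of the Peierls bound; z = 2q leaves a factor 2 for the exponential. *)
have qV : q^-1 = 64^-1 ^+ 16 by rewrite exprVn.
clearbody q.
pose z := 2 * q.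
have z1 : 1 <= z by rewrite /z; lra.
have z0 : 0 < z by lra.
have lz0 : 0 <= 2 ^+ 23 * z by rewrite mulr_ge0 ?exprn_ge0 // ltW.
pose l := (Num.Def.archi_bound (2 ^+ 23 * z)).+1.
have l0 : (0 < l)%N by [].
have lz : 2 ^+ 23 * z <= l%:R ^+ 2.
  have H := archi_boundP lz0.
  have lge : 2 ^+ 23 * z <= l%:R by rewrite (le_trans (ltW H)) // ler_nat.
  by rewrite (le_trans lge) // expr2 ler_peMr // ler1n.
clearbody l.
pose c := 2 * z * (l ^ 2)%:R.
have ll0 : 0 < (l ^ 2)%:R :> R by rewrite ltr0n expn_gt0 l0.
have c0 : 0 < c by apply: mulr_gt0 => //; lra.
(* Below this level u c < ln 2, so the exponential is at most 2 and dividing by [z] gives at most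
   1/q. *)
exists (ln 2 / c); first by rewrite divr_gt0 // ln_gt0 // ltr1n.
move=> u u0; rewrite ltr_pdivlMr // => uc dW W Px X srw dO Omega P I ri.
apply: (percolates d8 srw u0 ri l0 z1 lz).
rewrite -mulrA -/c -qV /z invfM mulrAC ler_piMl ?invr_ge0 ?(le_trans _ q1) //.
rewrite mulrC ler_pdivrMr // mul1r -[leRHS]lnK ?posrE // ler_expR; exact: ltW.
Qed.
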